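(* Let $p$ be a prime, let $n, m\geq 2$ be integers coprime to $p$, and let $h,\alpha,\beta$ be positive integers such that $\alpha n = \beta m = p^h-1$. Then the $p$-rank of the curve $\mathcal{F}_{m,n}: y^{m} = x^{n} + 1$ over $\overline{\mathbb{F}}_p$ is $$\gamma(\mathcal{F}_{m,n})=\#T-(m+n+\gcd(m,n)),$$ where $$T = \left\{ (i,j) \in \mathbb{N}^2 \;\middle|\; 0 \leq i\alpha \leq j\beta \leq p^h-1 \ \text{ and }\ \binom{j\beta}{i\alpha} \not\equiv 0 \pmod{p} \right\}.$$
   Context: $\mathbb{N}=\{0,1,2,\dots\}$. A ''curve'' given by an affine equation over $\overline{\mathbb{F}}_p$ means the nonsingular, projective, irreducible curve whose function field is defined by that equation. The $p$-rank $\gamma(\mathcal{X})$ of a curve $\mathcal{X}$ over $\overline{\mathbb{F}}_p$ with Jacobian $J$ is the integer such that $J[p](\overline{\mathbb{F}}_p)\cong(\mathbb{Z}/p\mathbb{Z})^{\gamma(\mathcal{X})}$, equivalently the dimension of the space of holomorphic differentials spanned by the logarithmic ones (those of the form $df/f$); a curve of genus $0$ has $p$-rank $0$. *)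

(* Defs.v *)
From HB Require Import structures.
From mathcomp Require Import all_boot all_order all_algebra.

Set Implicit Arguments.
Unset Strict Implicit.
Unset Printing Implicit Defensive.

Import GRing.Theory.
Local Open Scope ring_scope.

(* A curve over [F] is given by its function field: a field [K] with an
   embedding [iota : F -> K].  Its points are the places of [K / F]. *)

(* [F], with [phi : 'F_p -> F], is an algebraic closure of 'F_p ([F] is already
   algebraically closed by its type). *)
Definition algebraic_closure_Fp (p : nat) (F : closedFieldType)
    (phi : {rmorphism 'F_p -> F}) : Prop :=
  forall a : F, algebraicOver phi a.

(* The value at [(x, y)] of a bivariate polynomial with coefficients in [F]; as
   in [polyXY], the outer variable 'X is sent to [x] and the inner variable
   ['Y = 'X%:P] to [y]. *)
Definition eval2 (F K : fieldType) (iota : {rmorphism F -> K})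
    (Q : {poly {poly F}}) (x y : K) : K :=
  (map_poly (map_poly iota) Q).[x%:P].[y].

(* [K] is the field of fractions of F[X,Y]/(P), with [x] and [y] the classes of
   X and Y.  Since [K] is a field, the ideal (P) is then prime. *)
Record function_field_of (F K : fieldType) (iota : {rmorphism F -> K})
    (P : {poly {poly F}}) (x y : K) : Prop := FunctionFieldOf {
  ff_relations : forall Q : {poly {poly F}},
    eval2 iota Q x y = 0 <-> exists R : {poly {poly F}}, Q = R * P;
  ff_generated : forall z : K, exists Q1 Q2 : {poly {poly F}},
    eval2 iota Q2 x y != 0 /\ z = eval2 iota Q1 x y / eval2 iota Q2 x y }.

(* Y^m = X^n + 1 *)
Definition Fmn_poly (F : fieldType) (m n : nat) : {poly {poly F}} :=
  'X%:P ^+ m - ('X ^+ n + 1).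

(* A place is represented by its valuation ring [O]; for a function field of
   one variable these are automatically discrete and are in bijection with the
   points of the nonsingular projective model. *)
Record place (F K : fieldType) (iota : {rmorphism F -> K}) (O : K -> Prop) :
    Prop := Place {
  place_const : forall a : F, O (iota a);
  place_sub : forall u v : K, O u -> O v -> O (u - v);
  place_mul : forall u v : K, O u -> O v -> O (u * v);
  place_proper : exists z : K, ~ O z;
  place_valuation : forall z : K, z != 0 -> O z \/ O z^-1 }.

Definition max_ideal (K : fieldType) (O : K -> Prop) (z : K) : Prop :=
  O z /\ (z != 0 -> ~ O z^-1).

Definition local_parameter (K : fieldType) (O : K -> Prop) (t : K) : Prop :=
  forall z : K, max_ideal O z <-> exists2 u : K, O u & z = u * t.

Record derivation (F K : fieldType) (iota : {rmorphism F -> K})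
    (M : lmodType K) (D : K -> M) : Prop := Derivation {
  derivation_const : forall a : F, D (iota a) = 0;
  derivation_add : forall f g : K, D (f + g) = D f + D g;
  derivation_mul : forall f g : K, D (f * g) = f *: D g + g *: D f }.

(* [d : K -> Om] is the universal [F]-derivation, i.e. [Om] is the module of
   Kaehler differentials of [K / F]. *)
Record kaehler (F K : fieldType) (iota : {rmorphism F -> K})
    (Om : lmodType K) (d : K -> Om) : Prop := Kaehler {
  kaehler_derivation : derivation iota d;
  kaehler_lift : forall (M : lmodType K) (D : K -> M), derivation iota D ->
    exists psi : {linear Om -> M}, forall f : K, psi (d f) = D f;
  kaehler_unique : forall (M : lmodType K) (psi1 psi2 : {linear Om -> M}),
    (forall f : K, psi1 (d f) = psi2 (d f)) -> psi1 =1 psi2 }.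

Definition holomorphic (F K : fieldType) (iota : {rmorphism F -> K})
    (Om : lmodType K) (d : K -> Om) (w : Om) : Prop :=
  forall O : K -> Prop, place iota O ->
    exists t g : K, [/\ local_parameter O t, O g & w = g *: d t].

Definition logarithmic (K : fieldType) (Om : lmodType K) (d : K -> Om)
    (w : Om) : Prop :=
  exists2 f : K, f != 0 & w = f^-1 *: d f.

(* Linear combinations over the constant field [F], not over [K]. *)
Definition lincomb (F K : fieldType) (iota : {rmorphism F -> K})
    (Om : lmodType K) (r : nat) (a : 'I_r -> F) (e : 'I_r -> Om) : Om :=
  \sum_(i < r) iota (a i) *: e i.

Definition lin_span (F K : fieldType) (iota : {rmorphism F -> K})
    (Om : lmodType K) (S : Om -> Prop) (w : Om) : Prop :=
  exists (r : nat) (a : 'I_r -> F) (e : 'I_r -> Om),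
    (forall i, S (e i)) /\ w = lincomb iota a e.

(* The [F]-subspace [V] of [Om] has a basis with [r] elements. *)
Definition has_dim (F K : fieldType) (iota : {rmorphism F -> K})
    (Om : lmodType K) (V : Om -> Prop) (r : nat) : Prop :=
  exists e : 'I_r -> Om,
    [/\ forall i, V (e i),
        forall a : 'I_r -> F, lincomb iota a e = 0 -> forall i, a i = 0
      & forall w : Om, V w -> exists a : 'I_r -> F, w = lincomb iota a e].

Definition has_p_rank (F K : fieldType) (iota : {rmorphism F -> K})
    (Om : lmodType K) (d : K -> Om) (g : nat) : Prop :=
  has_dim iota
    (lin_span iota (fun w => holomorphic iota d w /\ logarithmic d w)) g.

(* For [alpha, beta > 0] the inequalities defining T force i, j <= p ^ h - 1, so
   that letting i and j range over 'I_(p ^ h) loses no pair. *)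
Definition T_set (p h alpha beta : nat) : {set 'I_(p ^ h) * 'I_(p ^ h)} :=
  [set ij : 'I_(p ^ h) * 'I_(p ^ h) |
     [&& (ij.1 * alpha <= ij.2 * beta)%N,
         (ij.2 * beta <= p ^ h - 1)%N
       & ~~ (p %| 'C(ij.2 * beta, ij.1 * alpha))%N]].

(* Main.v *)
Require Import Defs.
From HB Require Import structures.
From mathcomp Require Import all_boot all_order all_algebra all_solvable all_field.
From mathcomp Require Import ring zify boolp.
From mathcomp Require classical_sets.
Import GRing.Theory.
Local Open Scope ring_scope.

Set Implicit Arguments.
Unset Strict Implicit.
Unset Printing Implicit Defensive.

(** Write q = p^h, N = q - 1, and let C be the Cartier operator on the
    differentials of K / F, so that w is logarithmic exactly when C w = w.  The
    holomorphic differentials have as basis the monomials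
    x^(i-1) y^-b dx with i, b >= 1, b < m and i m < n b.  Since N = beta m,
    y^-b is the product of the q-th power of y^-b and of (x^n + 1)^(b beta);
    expanding this power and using q = 1 mod n, one finds that the h-th iterate
    of C multiplies the monomial (i, b) by the binomial coefficient of
    b beta and i alpha, an element of F_p.

    A logarithmic holomorphic form is fixed by C, hence by its h-th iterate, so it
    involves only monomials with nonzero eigenvalue.  Conversely a monomial with
    nonzero eigenvalue can be scaled to a form w fixed by the h-th iterate.  Then
    the forms sum_(k < h) C^k (theta^s w), with theta of order q - 1 in F, are
    holomorphic and fixed by C, and w is a combination of them.  The p-rank is
    therefore the number of (i, b) with i, b >= 1, b < m, i alpha < b beta and
    nonzero binomial coefficient.  The other elements of T lie on the three sides
    i = 0, j = m, i alpha = j beta of a triangle, where p never divides the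
    binomial coefficient; there are m + n + gcd(m, n) of them.

    Everything is expressed through the derivation D = d/dx of K, differentials
    being written G dx ([differential_line]).
    - Logarithmic forms.  Jacobson's formula (D + G)^p (1) = D^(p-1) G + G^p
      ([jacobson]) shows that G dx is logarithmic iff D^(p-1) G = - G^p, and
      C (G dx) = H dx means H^p = - D^(p-1) G ([cartier_logarithmic],
      [cartier_fixed], [cartier_iter_monomial]).
    - Holomorphic forms.  A differential is cut into its components under the
      automorphisms y -> zeta y, zeta^m = 1, which are f y^-b dx with f in F(x).
      Explicit local parameters at the places over a pole of f and at infinity
      show that f is a polynomial of bounded degree ([regular_component],
      [regular_span]).  Such places exist by Zorn's lemma ([place_exists]).
    - The three sides of the triangle are counted in [card_T_set]. *)

(** * Powers of a derivation and Jacobson's formula *)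

Section DerivationPowers.
Variables (K : fieldType) (D : {additive K -> K}).
Hypothesis DM : forall f g, D (f * g) = D f * g + f * D g.

Lemma derivation1 : D 1 = 0.
Proof.
have := DM 1 1; rewrite !mulr1 mul1r => /eqP.
by rewrite -subr_eq subrr => /eqP.
Qed.

Lemma derivation_exp f k : D (f ^+ k) = f ^+ k.-1 * D f *+ k.
Proof.
elim: k => [|k IHk]; first by rewrite expr0 derivation1 mulr0n.
rewrite exprS DM IHk /= mulrnAr mulrA mulrS [D f * _]mulrC.
by case: k {IHk} => [|k]; rewrite ?mulr0n //= -exprS.
Qed.

Lemma derivationV f : f != 0 -> D f^-1 = - (D f / f ^+ 2).
Proof.
move=> f0; have := DM f f^-1; rewrite mulfV // derivation1 => E.
have -> : D f^-1 = (D f * f^-1 + f * D f^-1) / f - D f / f ^+ 2 by field.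
by rewrite -E mul0r add0r.
Qed.

Lemma derivation_div f g : g != 0 -> D (f / g) = (D f * g - f * D g) / g ^+ 2.
Proof. by move=> g0; rewrite DM derivationV //; field. Qed.

Section Jacobson.
Variable G : K.

Definition twist (u : K) := D u + G * u.
(* D + s G, acting on polynomials in s with D s = 0. *)
Let A (u : {poly K}) := map_poly D u + G *: ('X * u).

Let A_coef0 u : (A u)`_0 = D u`_0.
Proof. by rewrite coefD coefZ coefXM eqxx mulr0 addr0 coef_map_id0 ?raddf0. Qed.

Let A_coefS u i : (A u)`_i.+1 = D u`_i.+1 + G * u`_i.
Proof. by rewrite coefD coefZ coefXM coef_map_id0 ?raddf0. Qed.

Let A_deriv u : (A u)^`() = A u^`() + G *: u.
Proof.
apply/polyP => -[|i]; rewrite !(coef_deriv, coefD, A_coefS, A_coef0, coefZ).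
  by rewrite !mulr1n.
rewrite raddfMn mulrnDl mulrnAr; ring.
Qed.

Let AD u v : A (u + v) = A u + A v.
Proof.
apply/polyP=> -[|i]; rewrite !(coefD, A_coef0, A_coefS) raddfD //.
by rewrite mulrDr addrACA.
Qed.

Let A0 : A 0 = 0.
Proof. by apply/polyP=> -[|i]; rewrite !(coef0, A_coef0, A_coefS) raddf0 // mulr0 addr0. Qed.

Let AZ c u : A (c *: u) = D c *: u + c *: A u.
Proof.
apply/polyP=> -[|i]; rewrite !(coefD, coefZ, A_coef0, A_coefS) DM //; ring.
Qed.

Let AMn u k : A (u *+ k) = A u *+ k.
Proof. by elim: k => [|k IH]; rewrite ?mulr0n ?A0 // !mulrS AD IH. Qed.

Let B k := iter k A 1.

Let B_deriv k :
  (B k)^`() = \sum_(j < k) (iter j D G *: B (k - j.+1)) *+ 'C(k, j.+1).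
Proof.
elim: k => [|k IHk]; first by rewrite big_ord0 /B /= derivC.
have -> : B k.+1 = A (B k) by [].
rewrite A_deriv IHk (big_morph A AD A0).
under eq_bigr => j _ do rewrite AMn AZ mulrnDl.
rewrite big_split /=.
under [RHS]eq_bigr => j _ do rewrite binS mulrnDr.
rewrite big_split /=.
rewrite [X in _ = _ + X]big_ord_recl /= bin0 mulr1n subn1 /=.
rewrite [X in _ = X + _]big_ord_recr /= bin_small // mulr0n addr0.
rewrite [X in X + _ = _]addrC -!addrA; congr (_ + _); last first.
  by rewrite addrC; congr (_ + _); apply: eq_bigr => j _.
apply: eq_bigr => j _; congr (_ *+ _); congr (_ *: _).
by have -> : (k.+1 - j.+1 = (k - j.+1).+1)%N by rewrite subSS subnSK.
Qed.

Let B_size k : (size (B k) <= k.+1)%N.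
Proof.
apply/leq_sizeP; elim: k => [|k IHk] [|i] // lt_ki.
  by rewrite /B /= coefC.
by rewrite /B iterS A_coefS !IHk ?raddf0 ?mulr0 ?addr0 // ltnW.
Qed.

Let B_lead k : (B k)`_k = G ^+ k.
Proof.
elim: k => [|k IHk]; first by rewrite /B /= coefC expr0.
by rewrite /B iterS A_coefS -/(B k) IHk (leq_sizeP _ _ (B_size k)) // raddf0 add0r exprS.
Qed.

Let B_horner k : (B k).[1] = iter k twist 1.
Proof.
elim: k => [|k IHk]; first by rewrite hornerC.
rewrite /= -IHk /twist /A hornerD hornerZ hornerM hornerX mul1r; congr (_ + _).
rewrite (horner_coef_wide _ (size_poly _ _)) (horner_coef (B k)) raddf_sum.
by apply: eq_bigr => i _; rewrite !expr1n !mulr1 coef_map_id0 ?raddf0.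
Qed.

(** Introduce an indeterminate s and B_k(s) = (D + s G)^k (1).  By induction
    dB_k/ds = sum_j binomial(k, j+1) D^j G B_(k-1-j); for k = p only the term
    j = p - 1 survives, so the coefficients of s^2, ..., s^(p-1) in B_p vanish,
    and those of 1, s and s^p are read off directly. *)
Lemma jacobson p : p \in [pchar K] ->
  iter p twist 1 = iter p.-1 D G + G ^+ p.
Proof.
move=> chp; have p_pr := pcharf_prime chp; have p_gt1 := prime_gt1 p_pr.
have dB : (B p)^`() = (iter p.-1 D G)%:P.
  rewrite B_deriv -(prednK (prime_gt0 p_pr)) big_ord_recr /= subnn binn mulr1n.
  rewrite big1 ?add0r => [|j _]; first by rewrite /B /= alg_polyC.
  rewrite (prednK (prime_gt0 p_pr)) -mulr_natr -polyC_natr.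
  have /eqP -> : ('C(p, j.+1)%:R == 0 :> K).
    rewrite -(dvdn_pcharf chp) prime_dvd_bin //=.
    by have := ltn_ord j; rewrite -ltnS (prednK (prime_gt0 p_pr)).
  by rewrite mulr0.
rewrite -B_horner (horner_coef_wide _ (B_size p)).
have B0 k : (B k.+1)`_0 = 0.
  rewrite /B iterS A_coef0; elim: k => [|k IHk]; first by rewrite coefC derivation1.
  by rewrite iterS A_coef0 IHk raddf0.
have cB i : (B p)`_i.+1 *+ i.+1 = if i == 0%N then iter p.-1 D G else 0.
  by rewrite -coef_deriv dB coefC.
move: dB cB; set d := iter _ _ _ => dB cB.
have pE := ltn_predK p_gt1; have p1_gt0 : (0 < p.-1)%N by rewrite -ltnS pE.
have p1E := prednK p1_gt0.
rewrite big_ord_recr /= expr1n mulr1 B_lead; congr (_ + _).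
rewrite -(big_mkord xpredT (fun i => (B p)`_i * 1 ^+ i)) -{1}pE -p1E big_nat_recl //.
rewrite big_nat_recl // -{1}pE B0 mul0r add0r expr1n mulr1.
have /= := cB 0%N; rewrite mulr1n => ->.
rewrite big_nat_cond big1 ?addr0 // => i /andP[/andP[_ lt_i] _].
have /eqP := cB i.+1; rewrite /= -mulr_natr mulf_eq0 => /orP[/eqP->|]; first by rewrite mul0r.
by rewrite -(dvdn_pcharf chp) gtnNdvd // -pE -p1E !ltnS.
Qed.

End Jacobson.

Section Logarithmic.
Variable p : nat.
Hypothesis chp : p \in [pchar K].
Hypothesis Dp0 : forall u, iter p D u = 0.

(** D + Df/f is D conjugated by multiplication by f, so its p-th power vanishes
    with D^p; Jacobson's formula evaluates that power at 1. *)
Lemma logarithmic_fixed f : f != 0 -> iter p.-1 D (D f / f) + (D f / f) ^+ p = 0.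
Proof.
move=> f0; rewrite -jacobson //.
suff E k u : iter k (twist (D f / f)) u = iter k D (u * f) / f by rewrite E Dp0 mul0r.
elim: k => [|k IHk] /=; first by rewrite mulfK.
rewrite IHk /twist derivation_div //; field; exact: f0.
Qed.

(** Jacobson's formula says that D - G kills 1 after p steps; the last nonzero
    iterate is a solution of Df = G f. *)
Lemma fixed_logarithmic G : iter p.-1 D G + G ^+ p = 0 ->
  exists2 f, f != 0 & D f = G * f.
Proof.
move=> GE.
have tw0 : iter p (twist (- G)) 1 = 0.
  have DN k : iter k D (- G) = - iter k D G by elim: k => //= k ->; rewrite raddfN.
  by rewrite jacobson // DN exprNn_pchar ?pnatE ?(pcharf_prime chp) // -opprD GE oppr0.
have exk : exists k, iter k (twist (- G)) 1 == 0 by exists p; rewrite tw0.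
have [[|k] /= /eqP Ek mink] := ex_minnP exk; first by move/eqP: Ek; rewrite oner_eq0.
exists (iter k (twist (- G)) 1).
  by apply/negP => /mink; rewrite ltnn.
by apply/eqP; rewrite -subr_eq0 -mulNr -[_ + _]/(twist _ _) Ek.
Qed.
End Logarithmic.
End DerivationPowers.

(** * The Cartier operator *)

Section Cartier.
Variables (K : fieldType) (D : {additive K -> K}) (p : nat) (x : K).
Hypothesis DM : forall f g, D (f * g) = D f * g + f * D g.
Hypothesis chp : p \in [pchar K].
Hypothesis Dx : D x = 1.
Hypothesis gen : forall G : K, exists Q : {poly K}, G = \sum_(i < size Q) Q`_i ^+ p * x ^+ i.

Let p_pr := pcharf_prime chp.

Lemma exp_pchar_inj : injective (fun a : K => a ^+ p).
Proof. by move=> a b; rewrite -!(pFrobenius_autE chp) => /fmorph_inj. Qed.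

Lemma derivation_pexp a : D (a ^+ p) = 0.
Proof. by rewrite derivation_exp // -mulr_natr pcharf0 // mulr0. Qed.

Lemma iter_derivation_pexp k a u : iter k D (a ^+ p * u) = a ^+ p * iter k D u.
Proof. by elim: k => //= k ->; rewrite DM derivation_pexp mul0r add0r. Qed.

Lemma iter_derivation_sum k I (r : seq I) (P : pred I) (g : I -> K) :
  iter k D (\sum_(i <- r | P i) g i) = \sum_(i <- r | P i) iter k D (g i).
Proof. by elim: k => //= k ->; rewrite raddf_sum. Qed.

Lemma iter_derivation_var k N : iter k D (x ^+ N) = (N ^_ k)%:R * x ^+ (N - k).
Proof.
elim: k => [|k IHk] /=; first by rewrite ffactn0 mul1r subn0.
rewrite IHk mulr_natl raddfMn /= derivation_exp // Dx mulr1 ffactnSr natrM -subnS.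
by rewrite -mulrnA mulnC -natrM mulr_natl.
Qed.

Lemma iter_derivation_p u : iter p D u = 0.
Proof.
have [Q ->] := gen u; rewrite iter_derivation_sum big1 // => i _.
rewrite iter_derivation_pexp iter_derivation_var.
have /eqP -> : (i ^_ p)%:R == 0 :> K; last by rewrite mul0r mulr0.
rewrite -(dvdn_pcharf chp) -bin_ffact dvdn_mull // dvdn_fact //.
by rewrite prime_gt0 ?leqnn.
Qed.

(** The falling factorial N (N-1) ... (N-p+2) has a factor divisible by p unless
    p divides N + 1, when it is (p-1)! up to sign and Wilson's theorem
    applies. *)
Lemma iter_derivation_pred_var N :
  iter p.-1 D (x ^+ N) = if (p %| N.+1)%N then - x ^+ (N.+1 - p) else 0.
Proof.
have p_gt0 := prime_gt0 p_pr.
rewrite iter_derivation_var.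
have -> : (N - p.-1 = N.+1 - p)%N by rewrite -[in RHS](prednK p_gt0) subSS.
case: ifPn => pN; last first.
  suff /eqP -> : (N ^_ p.-1)%:R == 0 :> K by rewrite mul0r.
  rewrite -(dvdn_pcharf chp) ffact_prod.
  have lt_r : (N %% p < p.-1)%N.
    rewrite ltn_neqAle -ltnS prednK // ltn_mod p_gt0 andbT.
    apply: contra pN => /eqP E.
    by rewrite /dvdn -addn1 -modnDml E addn1 prednK ?modnn.
  rewrite (bigD1 (Ordinal lt_r)) //= dvdn_mulr // {1}(divn_eq N p) addnK dvdn_mull //.
rewrite -mulN1r; congr (_ * _).
have N1 : N%:R = -1 :> K.
  by apply/eqP; rewrite -addr_eq0 -[1]/1%:R -natrD addn1 -(dvdn_pcharf chp).
have lepN : (p.-1 <= N)%N by rewrite -ltnS prednK // dvdn_leq.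
rewrite ffact_prod natr_prod.
under eq_bigr => i _ do
  rewrite natrB ?(leq_trans (ltnW (ltn_ord i))) // N1 -opprD -[1]/1%:R -natrD add1n -mulN1r.
rewrite big_split /= prodr_const card_ord -natr_prod.
have <- : (p.-1)`! = \prod_(i < p.-1) i.+1 by rewrite fact_prod big_add1 /= big_mkord.
have -> : ((p.-1)`!)%:R = -1 :> K.
  by apply/eqP; rewrite -addr_eq0 -[1]/1%:R -natrD addn1 -(dvdn_pcharf chp) -Wilson ?prime_gt1.
by rewrite -exprSr prednK // exprNn_pchar ?pnatE ?expr1n.
Qed.

Lemma cartier_ex G : exists H, H ^+ p == - iter p.-1 D G.
Proof.
have [Q ->] := gen G.
exists (\sum_(i < size Q) (if (p %| i.+1)%N then Q`_i * x ^+ (i.+1 %/ p).-1 else 0)).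
rewrite -(pFrobenius_autE chp) rmorph_sum /= iter_derivation_sum -sumrN; apply/eqP.
apply: eq_bigr => i _; rewrite iter_derivation_pexp iter_derivation_pred_var.
case: ifP => [pi|_]; last by rewrite rmorph0 mulr0 oppr0.
rewrite pFrobenius_autE exprMn mulrN opprK; congr (_ * _).
rewrite -exprM -subn1 mulnBl mul1n divnK //.
Qed.

(** In the coordinate [x], the Cartier operator maps [G dx] to [cartier G dx]. *)
Definition cartier (G : K) : K := xchoose (cartier_ex G).

Lemma cartierP G : cartier G ^+ p = - iter p.-1 D G.
Proof. exact/eqP/(xchooseP (cartier_ex G)). Qed.

Lemma cartierD G H : cartier (G + H) = cartier G + cartier H.
Proof.
apply: exp_pchar_inj; rewrite /= -[(_ + _) ^+ p](pFrobenius_autE chp) rmorphD /=.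
rewrite !pFrobenius_autE !cartierP -opprD; congr (- _).
by elim: p.-1 => //= k ->; rewrite raddfD.
Qed.

Lemma cartier0 : cartier 0 = 0.
Proof. by have /eqP := cartierD 0 0; rewrite addr0 -subr_eq subrr => /eqP. Qed.

Lemma cartierZ a G : cartier (a ^+ p * G) = a * cartier G.
Proof. by apply: exp_pchar_inj; rewrite /= exprMn !cartierP iter_derivation_pexp mulrN. Qed.

Lemma cartier_var N :
  cartier (x ^+ N) = if (p %| N.+1)%N then x ^+ (N.+1 %/ p).-1 else 0.
Proof.
apply: exp_pchar_inj; rewrite /= cartierP iter_derivation_pred_var.
case: ifP => [pN|_]; last by rewrite expr0n gtn_eqF ?prime_gt0 ?oppr0.
by rewrite opprK -exprM -subn1 mulnBl mul1n divnK.
Qed.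

Lemma cartier_sum I (r : seq I) (P : pred I) (g : I -> K) :
  cartier (\sum_(i <- r | P i) g i) = \sum_(i <- r | P i) cartier (g i).
Proof. exact: (big_morph cartier cartierD cartier0). Qed.

Lemma cartierMn G k : cartier (G *+ k) = cartier G *+ k.
Proof. by elim: k => [|k IH]; rewrite ?mulr0n ?cartier0 // !mulrS cartierD IH. Qed.

Lemma cartier_logarithmic f : f != 0 -> cartier (D f / f) = D f / f.
Proof.
move=> f0; apply: exp_pchar_inj; rewrite /= cartierP.
by apply/eqP; rewrite eqr_oppLR -addr_eq0 logarithmic_fixed //; apply: iter_derivation_p.
Qed.

Lemma cartier_fixed G : cartier G = G -> exists2 f, f != 0 & D f = G * f.
Proof.
move=> CG; apply: (fixed_logarithmic DM chp).
by apply/eqP; rewrite addr_eq0 -{2}CG cartierP opprK.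
Qed.

Lemma cartier_iterD k G H : iter k cartier (G + H) = iter k cartier G + iter k cartier H.
Proof. by elim: k => //= k ->; rewrite cartierD. Qed.

Lemma cartier_iter0 k : iter k cartier 0 = 0.
Proof. by elim: k => //= k ->; rewrite cartier0. Qed.

Lemma cartier_iter_sum k I (r : seq I) (P : pred I) (g : I -> K) :
  iter k cartier (\sum_(i <- r | P i) g i) = \sum_(i <- r | P i) iter k cartier (g i).
Proof. exact: (big_morph _ (cartier_iterD k) (cartier_iter0 k)). Qed.

Lemma cartier_iterZ k a G : iter k cartier (a ^+ (p ^ k) * G) = a * iter k cartier G.
Proof.
by elim: k a => [|k IHk] a /=; rewrite ?expn0 ?expr1 // expnS exprM IHk cartierZ.
Qed.

Lemma cartier_iterMn k G j : iter k cartier (G *+ j) = iter k cartier G *+ j.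
Proof. by elim: k => //= k ->; rewrite cartierMn. Qed.

Lemma cartier_iter_var k N : iter k cartier (x ^+ N) =
  if (p ^ k %| N.+1)%N then x ^+ (N.+1 %/ p ^ k).-1 else 0.
Proof.
elim: k => [|k IHk] /=; first by rewrite expn0 dvd1n divn1.
rewrite IHk; case: ifPn => [dk|ndk]; last first.
  rewrite cartier0 ifN //; apply: contra ndk; apply: dvdn_trans.
  by rewrite expnS dvdn_mull.
rewrite cartier_var prednK ?divn_gt0 ?expn_gt0 ?prime_gt0 // ?(dvdn_leq _ dk) //.
by rewrite -divnMA -expnSr dvdn_divRL // -expnS.
Qed.

End Cartier.

(** * Roots in an algebraically closed field *)

Lemma closed_prim_root (F : closedFieldType) n : n%:R != 0 :> F ->
  exists z : F, n.-primitive_root z.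
Proof.
case: n => [|n]; first by rewrite eqxx.
move=> n0; have n_gt0 : (0 < n.+1)%N by [].
pose p : {poly F} := 'X^(n.+1) - 1; have [r Dp] := closed_field_poly_normal p.
rewrite (monicP _) ?monicXnsubC // scale1r in Dp.
have rn1 : all n.+1.-unity_root r by apply/allP=> z; rewrite -root_prod_XsubC -Dp.
have sz_r : (n.+1 < (size r).+1)%N.
  by rewrite -(size_prod_XsubC r id) -Dp size_XnsubC.
have [|z] := hasP (has_prim_root n_gt0 rn1 _ sz_r); last by exists z.
by rewrite -separable_prod_XsubC -Dp separable_Xn_sub_1.
Qed.

Lemma prim_root_sum (R : idomainType) n (z : R) j : n.-primitive_root z ->
  \sum_(k < n) z ^+ (k * j) = if (n %| j)%N then n%:R else 0.
Proof.
move=> pz; under eq_bigr => k _ do rewrite mulnC exprM.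
case: ifPn => nj.
  rewrite (prim_order_dvd pz) in nj; rewrite (eqP nj).
  under eq_bigr => k _ do rewrite expr1n.
  by rewrite sumr_const card_ord.
have /eqP := subrX1 (z ^+ j) n; rewrite -exprM mulnC exprM (prim_expr_order pz).
rewrite expr1n subrr eq_sym mulf_eq0 subr_eq0 => /orP[|/eqP //].
by rewrite -(prim_order_dvd pz) (negPf nj).
Qed.

Lemma closed_nth_root (F : closedFieldType) n (c : F) : (0 < n)%N ->
  exists b, b ^+ n = c.
Proof.
move=> n_gt0; have /closed_rootP[b] : size ('X^n - c%:P) != 1%N.
  by rewrite size_XnsubC // eqSS -lt0n.
by rewrite rootE !hornerE subr_eq0 => /eqP; exists b.
Qed.

(** * Evaluating bivariate polynomials *)

Section Evaluation.
Variables (F : fieldType) (L : comNzRingType) (j : {rmorphism F -> L}) (u v : L).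

Definition ev : {rmorphism {poly {poly F}} -> L} :=
  horner_eval v \o horner_eval u%:P \o map_poly (map_poly j).

Lemma evX : ev 'X = u.
Proof. by rewrite /ev /= map_polyX /horner_eval hornerX hornerC. Qed.

Lemma evY : ev 'X%:P = v.
Proof. by rewrite /ev /= map_polyC /horner_eval hornerC /= map_polyX hornerX. Qed.

Lemma evC a : ev a%:P%:P = j a.
Proof. by rewrite /ev /= map_polyC /horner_eval hornerC /= map_polyC hornerC. Qed.

Lemma ev_polyC f : ev (map_poly polyC f) = (map_poly j f).[u].
Proof.
rewrite /ev /= /horner_eval -map_poly_comp (eq_map_poly (g := polyC \o j)) => [|a] /=.
  by rewrite map_poly_comp horner_map hornerC.
by rewrite map_polyC.
Qed.

Lemma ev_sum Q :
  ev Q = \sum_(i < size Q) \sum_(k < size Q`_i) j Q`_i`_k * v ^+ k * u ^+ i.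
Proof.
rewrite -{1}[Q]coefK poly_def rmorph_sum; apply: eq_bigr => i _.
rewrite -mul_polyC rmorphM rmorphXn evX -mulr_suml; congr (_ * _).
rewrite -{1}[Q`_i]coefK poly_def !rmorph_sum; apply: eq_bigr => k _.
by rewrite -mul_polyC !rmorphM !rmorphXn evC evY.
Qed.
End Evaluation.

Lemma rmorph_ev (F : fieldType) (L M : comNzRingType) (j : {rmorphism F -> L})
    (h : {rmorphism L -> M}) (j' : {rmorphism F -> M}) u v Q :
  (forall a, h (j a) = j' a) -> h (ev j u v Q) = ev j' (h u) (h v) Q.
Proof.
move=> hj; rewrite !ev_sum rmorph_sum; apply: eq_bigr => i _; rewrite rmorph_sum.
by apply: eq_bigr => k _; rewrite !rmorphM !rmorphXn hj.
Qed.

(** * Extending maps from F[X,Y] to the function field *)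

Section Extension.
Variables (A : comNzRingType) (K : fieldType) (e : {rmorphism A -> K}).
Hypothesis gen : forall z : K, exists a b, e b != 0 /\ z = e a / e b.

Let frac_ex z : exists ab : A * A, (e ab.2 != 0) && (z == e ab.1 / e ab.2).
Proof. by have [a [b [b0 ->]]] := gen z; exists (a, b); rewrite b0 eqxx. Qed.

Let num z := (xchoose (frac_ex z)).1.
Let den z := (xchoose (frac_ex z)).2.

Let den0 z : e (den z) != 0.
Proof. by have /andP[] := xchooseP (frac_ex z). Qed.

Let numE z : e (num z) = z * e (den z).
Proof.
have /andP[_ /eqP E] := xchooseP (frac_ex z).
by apply: (canRL (divfK (den0 z))); apply: esym.
Qed.

Lemma extend_rmorphism (e' : {rmorphism A -> K}) :
    (forall a, e a = 0 <-> e' a = 0) ->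
  exists s : {rmorphism K -> K}, forall a, s (e a) = e' a.
Proof.
move=> ker; pose s z := e' (num z) / e' (den z).
have den'0 b : e b != 0 -> e' b != 0.
  by apply: contra => /eqP/ker->.
have sE z a b : e b != 0 -> e a = z * e b -> s z = e' a / e' b.
  move=> b0 za; apply/eqP; rewrite /s eqr_div ?den'0 // -!rmorphM -subr_eq0 -rmorphB.
  apply/eqP/ker; rewrite rmorphB !rmorphM za numE; ring.
have s_e a : s (e a) = e' a by rewrite (sE _ a 1) ?rmorph1 ?oner_eq0 ?mulr1 ?divr1.
have sB : zmod_morphism s.
  move=> u v; rewrite (sE _ (num u * den v - num v * den u) (den u * den v)).
  - rewrite rmorphB !rmorphM /s; by field; apply/andP; split; apply/den'0/den0.
  - by rewrite rmorphM mulf_neq0 ?den0.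
  - by rewrite rmorphB !rmorphM !numE; ring.
have sM : monoid_morphism s.
  split=> [|u v]; first by rewrite -[1](rmorph1 e) s_e !rmorph1.
  rewrite (sE _ (num u * num v) (den u * den v)).
  - rewrite !rmorphM /s; by field; apply/andP; split; apply/den'0/den0.
  - by rewrite rmorphM mulf_neq0 ?den0.
  - by rewrite !rmorphM !numE; ring.
pose sm : {rmorphism K -> K} := HB.pack s
  (GRing.isZmodMorphism.Build K K s sB) (GRing.isMonoidMorphism.Build K K s sM).
by exists sm.
Qed.

Lemma extend_derivation (d : {additive A -> K}) :
    (forall a b, d (a * b) = d a * e b + e a * d b) ->
    (forall a, e a = 0 -> d a = 0) ->
  exists D : {additive K -> K},
    (forall u v, D (u * v) = D u * v + u * D v) /\ forall a, D (e a) = d a.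
Proof.
move=> dM ker; pose D z := (d (num z) - z * d (den z)) / e (den z).
have DE z a b : e b != 0 -> e a = z * e b -> D z = (d a - z * d b) / e b.
  move=> b0 za; apply/eqP; rewrite /D eqr_div ?den0 //; apply/eqP.
  have : d (num z * b - a * den z) = 0.
    by apply: ker; rewrite rmorphB !rmorphM za numE; ring.
  rewrite raddfB !dM za numE => dE.
  apply/eqP; rewrite -subr_eq0; apply/eqP; rewrite -[RHS]dE; ring.
have D_e a : D (e a) = d a.
  have d1 : d 1 = 0.
    have := dM 1 1; rewrite !mulr1 rmorph1 mulr1 mul1r => /eqP.
    by rewrite -subr_eq subrr => /eqP.
  by rewrite (DE _ a 1) ?rmorph1 ?oner_eq0 ?mulr1 // d1 mulr0 subr0 divr1.
have DB : zmod_morphism D.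
  move=> u v; rewrite (DE _ (num u * den v - num v * den u) (den u * den v)).
  - rewrite rmorphM raddfB /= !dM !numE /D; by field; apply/andP; split; apply: den0.
  - by rewrite rmorphM mulf_neq0 ?den0.
  - by rewrite rmorphB !rmorphM !numE; ring.
pose Dm : {additive K -> K} := HB.pack D (GRing.isZmodMorphism.Build K K D DB).
exists Dm; split=> // u v.
rewrite [LHS](DE _ (num u * num v) (den u * den v)).
- rewrite /= !rmorphM !dM !numE /D; by field; apply/andP; split; apply: den0.
- by rewrite rmorphM mulf_neq0 ?den0.
- by rewrite !rmorphM !numE; ring.
Qed.
End Extension.

(** * The ring generated by two elements *)

(** The subring F[s, w] of K, given inductively so that properties of its
    elements can be checked on generators. *)
Inductive adjoin (F K : fieldType) (iota : {rmorphism F -> K}) (s w : K) : K -> Prop :=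
| adjoin_const a : adjoin iota s w (iota a)
| adjoin_l : adjoin iota s w s
| adjoin_r : adjoin iota s w w
| adjoin_sub u v : adjoin iota s w u -> adjoin iota s w v -> adjoin iota s w (u - v)
| adjoin_mul u v : adjoin iota s w u -> adjoin iota s w v -> adjoin iota s w (u * v).

Section Adjoin.
Variables (F K : fieldType) (iota : {rmorphism F -> K}) (s w : K).
Local Notation A := (adjoin iota s w).

Lemma adjoin0 : A 0. Proof. by rewrite -(rmorph0 iota); apply: adjoin_const. Qed.
Lemma adjoin1 : A 1. Proof. by rewrite -(rmorph1 iota); apply: adjoin_const. Qed.

Lemma adjoinN u : A u -> A (- u).
Proof. by move=> Au; rewrite -sub0r; apply: adjoin_sub => //; apply: adjoin0. Qed.

Lemma adjoin_add u v : A u -> A v -> A (u + v).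
Proof. by move=> Au Av; rewrite -[v]opprK; apply: adjoin_sub => //; apply: adjoinN. Qed.

Lemma adjoinX u k : A u -> A (u ^+ k).
Proof. by move=> Au; elim: k => [|k IH]; [apply: adjoin1 | rewrite exprS; apply: adjoin_mul]. Qed.

Lemma adjoin_bigsum I (r : seq I) (P : pred I) (g : I -> K) :
  (forall i, P i -> A (g i)) -> A (\sum_(i <- r | P i) g i).
Proof. by move=> Ag; apply: big_ind => //; [apply: adjoin0 | apply: adjoin_add]. Qed.

Lemma adjoin_bigprod I (r : seq I) (P : pred I) (g : I -> K) :
  (forall i, P i -> A (g i)) -> A (\prod_(i <- r | P i) g i).
Proof. by move=> Ag; apply: big_ind => //; [apply: adjoin1 | apply: adjoin_mul]. Qed.

Lemma adjoin_ev Q : A (ev iota s w Q).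
Proof.
rewrite ev_sum; apply: adjoin_bigsum => i _; apply: adjoin_bigsum => k _.
apply: adjoin_mul; last exact/adjoinX/adjoin_l.
by apply: adjoin_mul; [apply: adjoin_const | apply/adjoinX/adjoin_r].
Qed.

Lemma adjoinP z : A z -> exists Q, z = ev iota s w Q.
Proof.
elim=> [a|||u v _ [Q ->] _ [R ->]|u v _ [Q ->] _ [R ->]].
- by exists a%:P%:P; rewrite evC.
- by exists 'X; rewrite evX.
- by exists 'X%:P; rewrite evY.
- by exists (Q - R); rewrite rmorphB.
- by exists (Q * R); rewrite rmorphM.
Qed.
End Adjoin.

(** * The function field of y^m = x^n + 1 *)

Lemma natr_image_neq0 (F K : fieldType) (iota : {rmorphism F -> K}) k :
  k%:R != 0 :> F -> k%:R != 0 :> K.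
Proof. by rewrite -(rmorph_nat iota) fmorph_eq0. Qed.

Section FunctionField.
Variables (m n : nat) (F : closedFieldType) (K : fieldType).
Variables (iota : {rmorphism F -> K}) (x y : K).
Hypothesis hK : function_field_of iota (Fmn_poly F m n) x y.
Hypotheses (m_gt0 : (0 < m)%N) (n_gt0 : (0 < n)%N).
Hypotheses (mF : m%:R != 0 :> F) (nF : n%:R != 0 :> F).

Local Notation A := (adjoin iota x y).

Lemma ev_Fmn (L : comNzRingType) (j : {rmorphism F -> L}) u v :
  ev j u v (Fmn_poly F m n) = v ^+ m - (u ^+ n + 1).
Proof. by rewrite /Fmn_poly rmorphB rmorphD !rmorphXn rmorph1 evX evY. Qed.

Lemma curve_eq : y ^+ m = x ^+ n + 1.
Proof.
apply/eqP; rewrite -subr_eq0 -(ev_Fmn iota); apply/eqP.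
by apply/(ff_relations hK); exists 1; rewrite mul1r.
Qed.

Lemma ev_ker Q : ev iota x y Q = 0 -> exists R, Q = R * Fmn_poly F m n.
Proof. by move/(ff_relations hK). Qed.

Lemma function_field_ratio z : exists a b, ev iota x y b != 0 /\ z = ev iota x y a / ev iota x y b.
Proof. exact: (ff_generated hK). Qed.

Lemma function_field_frac z : exists a b, [/\ A a, A b, b != 0 & z = a / b].
Proof.
have [a [b [b0 ->]]] := function_field_ratio z.
by exists (ev iota x y a), (ev iota x y b); split=> //; apply: adjoin_ev.
Qed.

Lemma function_field_ind (P : K -> Prop) :
    (forall a, P (iota a)) -> P x -> P y ->
    (forall u v, P u -> P v -> P (u - v)) ->
    (forall u v, P u -> P v -> P (u * v)) ->
    (forall u, u != 0 -> P u -> P u^-1) ->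
  forall z, P z.
Proof.
move=> PF Px Py PB PM PV z; have [a [b [Aa Ab b0 ->]]] := function_field_frac z.
have PA u : A u -> P u by elim=> // ? ? _ ? _ ?; [apply: PB | apply: PM].
by apply: PM; [|apply: PV => //]; apply: PA.
Qed.

(** A polynomial f(x) that vanishes in K is a multiple of the equation of the
    curve, so it vanishes at the abscissa of every point; but over an
    algebraically closed field every a is the abscissa of a point. *)
Lemma x_transcendental (f : {poly F}) : f != 0 -> (map_poly iota f).[x] != 0.
Proof.
move=> f0; apply/eqP => fx.
have [R fR] : exists R, map_poly polyC f = R * Fmn_poly F m n.
  by apply: ev_ker; rewrite ev_polyC.
have [a fa] : exists a, f.[a] != 0.
  have [s1|s1] := boolP (size f == 1%N).
    have /size_poly1P[c c0 fc] := s1; exists 0; by rewrite fc hornerC.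
  have /closed_rootP[a] : size (f - 1) != 1%N.
    rewrite size_polyDl // size_polyN size_polyC oner_eq0 ltn_neqAle eq_sym s1.
    by rewrite size_poly_gt0.
  by rewrite rootE !hornerE subr_eq0 => /eqP E; exists a; rewrite E oner_eq0.
have [b bE] := closed_nth_root (a ^+ n + 1) m_gt0.
have : ev idfun a b (map_poly polyC f) = 0.
  by rewrite fR rmorphM ev_Fmn bE subrr mulr0.
by rewrite ev_polyC map_poly_id // => /eqP; rewrite (negPf fa).
Qed.

Lemma x_sub_neq0 a : x - iota a != 0.
Proof.
have := @x_transcendental ('X - a%:P); rewrite polyXsubC_eq0 => /(_ isT).
by rewrite rmorphB /= map_polyX map_polyC hornerXsubC.
Qed.

Lemma x_neq0 : x != 0.
Proof. by have := x_sub_neq0 0; rewrite rmorph0 subr0. Qed.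

Lemma xn1_neq0 : x ^+ n + 1 != 0.
Proof.
have := @x_transcendental ('X^n + 1); rewrite rmorphD rmorphXn rmorph1 /= map_polyX !hornerE.
by apply; rewrite -size_poly_gt0 size_XnaddC.
Qed.

Lemma y_neq0 : y != 0.
Proof. by apply: contraNneq xn1_neq0 => y0; rewrite -curve_eq y0 expr0n gtn_eqF. Qed.


(** The derivation comes from the dual numbers over K: the coefficient of eps in
    Q(x + eps, y + y' eps) is a derivation of F[X,Y], which kills the equation of
    the curve when y' = n x^(n-1) / (m y^(m-1)). *)
Lemma derivation_ex : exists D : {additive K -> K},
  [/\ forall u v, D (u * v) = D u * v + u * D v,
      forall a, D (iota a) = 0 & D x = 1].
Proof.
pose y' := n%:R * x ^+ n.-1 / (m%:R * y ^+ m.-1).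
pose j : {rmorphism F -> {poly K}} := polyC \o iota.
pose E := ev j (x%:P + 'X) (y%:P + y' *: 'X).
have E0 Q : (E Q)`_0 = ev iota x y Q.
  rewrite -horner_coef0 -[LHS]/(horner_eval 0 (E Q)) (rmorph_ev (j' := iota)).
    by rewrite /= /horner_eval !hornerE ?mulr0 ?addr0.
  by move=> a; rewrite /= /horner_eval hornerC.
pose d Q := (E Q)`_1.
have dB : zmod_morphism d by move=> u v; rewrite /d rmorphB coefB.
pose dm : {additive {poly {poly F}} -> K} := HB.pack d
  (GRing.isZmodMorphism.Build _ _ d dB).
have dM a b : dm (a * b) = dm a * ev iota x y b + ev iota x y a * dm b.
  change ((E (a * b))`_1 = (E a)`_1 * ev iota x y b + ev iota x y a * (E b)`_1).
  rewrite -!E0 rmorphM; move: (E a) (E b) => u v.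
  by rewrite coefM !big_ord_recl big_ord0 addr0 addrC.
have coef1X (u : {poly K}) k : (u ^+ k.+1)`_1 = u`_0 ^+ k * u`_1 *+ k.+1.
  elim: k => [|k IHk]; first by rewrite !expr1 expr0 mul1r.
  rewrite exprS coefM !big_ord_recl big_ord0 /= addr0 /bump /= subn0 subnn IHk.
  have -> : (u ^+ k.+1)`_0 = u`_0 ^+ k.+1 by rewrite -!horner_coef0 horner_exp.
  by rewrite mulrnAr mulrA -exprS [u`_1 * _]mulrC addrC -mulrS.
have dP : dm (Fmn_poly F m n) = 0.
  rewrite /= /d /E ev_Fmn coefB coefD coef1 addr0.
  have -> : m = m.-1.+1 by rewrite prednK.
  have -> : n = n.-1.+1 by rewrite prednK.
  rewrite !coef1X !coefD !coefC !coefZ !coefX /= !addr0 !mulr0 !addr0 !add0r !mulr1 !prednK //.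
  rewrite -mulr_natr -[X in _ - X]mulr_natr /y'; field.
  by rewrite (natr_image_neq0 iota mF) expf_neq0 // y_neq0.
have [|D [DM DE]] := extend_derivation function_field_ratio dM.
  by move=> Q /ev_ker[R ->]; rewrite dM dP ev_Fmn curve_eq subrr mulr0 mulr0 addr0.
exists D; split=> //.
- by move=> a; rewrite -(evC iota x y) DE /= /d /E evC coefC.
- by rewrite -[x in D x](evX iota x y) DE /= /d /E evX coefD coefC coefX add0r.
Qed.

(** The substitution Y -> c Y preserves the equation of the curve, and so does its
    inverse; hence it preserves the ideal of relations. *)
Lemma automorphism_ex c : c ^+ m = 1 -> exists s : {rmorphism K -> K},
  [/\ forall a, s (iota a) = iota a, s x = x & s y = iota c * y].
Proof.
move=> cm; have c0 : c != 0.
  by apply: contra_eq_neq cm => ->; rewrite expr0n gtn_eqF // eq_sym oner_eq0.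
pose e b := ev iota x (iota b * y).
have eP b : b ^+ m = 1 -> e b (Fmn_poly F m n) = 0.
  by move=> bm; rewrite /e ev_Fmn exprMn -rmorphXn bm rmorph1 mul1r curve_eq subrr.
pose jj : {rmorphism F -> {poly {poly F}}} := polyC \o polyC.
pose rho := ev jj 'X (c%:P%:P * 'X%:P).
have e_rho b Q : e b (rho Q) = e (b * c) Q.
  rewrite /e (rmorph_ev (j' := iota)); last by move=> a; rewrite -[jj a]/(a%:P%:P) evC.
  by rewrite evX [ev _ _ _ (_ * _)]rmorphM evC evY rmorphM mulrCA mulrA.
have e1 : e 1 = ev iota x y by rewrite /e rmorph1 mul1r.
have [|s sE] := extend_rmorphism function_field_ratio (e' := e c).
  move=> Q; split=> [/ev_ker[R ->]|]; first by rewrite rmorphM eP ?mulr0.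
  rewrite -[c]mul1r -e_rho e1 => /ev_ker[R rQ].
  by rewrite -e1 -(mulVf c0) -e_rho rQ rmorphM eP ?mulr0 // exprVn cm invr1.
exists s; split=> [a||].
- by rewrite -{1}(evC iota x y) sE /e evC.
- by rewrite -{1}(evX iota x y) sE /e evX.
- by rewrite -{1}(evY iota x y) sE /e evY.
Qed.

End FunctionField.

(** * Valuation rings *)

Section Place.
Variables (F K : fieldType) (iota : {rmorphism F -> K}) (O : K -> Prop).
Hypothesis hO : place iota O.
Local Notation M := (max_ideal O).

Definition place_unit (z : K) := [/\ z != 0, O z & O z^-1].
Local Notation U := place_unit.

Let OB := place_sub hO.
Let OM := place_mul hO.
Let OF := place_const hO.

Lemma place0 : O 0. Proof. by rewrite -(rmorph0 iota). Qed.
Lemma place1 : O 1. Proof. by rewrite -(rmorph1 iota). Qed.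
Lemma placeN u : O u -> O (- u).
Proof. by move=> Ou; rewrite -sub0r; apply: OB => //; apply: place0. Qed.
Lemma placeD u v : O u -> O v -> O (u + v).
Proof. by move=> Ou Ov; rewrite -[v]opprK; apply: OB => //; apply: placeN. Qed.
Lemma placeX u k : O u -> O (u ^+ k).
Proof. by move=> Ou; elim: k => [|k IH]; [apply: place1 | rewrite exprS; apply: OM]. Qed.
Lemma place_nat k : O k%:R.
Proof. by rewrite -(rmorph_nat iota). Qed.
Lemma place_bigsum I (r : seq I) (P : pred I) (g : I -> K) :
  (forall i, P i -> O (g i)) -> O (\sum_(i <- r | P i) g i).
Proof. by move=> Ag; apply: big_ind => //; [apply: place0 | apply: placeD]. Qed.

Lemma max_ideal_sub u : M u -> O u. Proof. by case. Qed.

Lemma max_ideal0 : M 0.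
Proof. by split; [apply: place0 | rewrite eqxx]. Qed.

Lemma place_cases z : O z -> M z \/ U z.
Proof.
move=> Oz; have [->|z0] := eqVneq z 0; first by left; apply: max_ideal0.
by have [Ozi|Ozi] := EM (O z^-1); [right | left; split].
Qed.

Lemma max_ideal_nunit z : M z -> ~ U z.
Proof. by move=> [_ nz] [z0 _]; apply: nz. Qed.

Lemma place_unit_sub z : U z -> O z. Proof. by case. Qed.
Lemma place_unit_neq0 z : U z -> z != 0. Proof. by case. Qed.

Lemma place_unitM u v : U u -> U v -> U (u * v).
Proof.
move=> [u0 Ou Oui] [v0 Ov Ovi]; split; first exact: mulf_neq0.
  exact: OM.
by rewrite invfM; apply: OM.
Qed.

Lemma place_unitV u : U u -> U u^-1.
Proof. by move=> [u0 Ou Oui]; split; rewrite ?invr_eq0 ?invrK. Qed.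

Lemma place_unit1 : U 1.
Proof. by split; rewrite ?oner_eq0 ?invr1 //; apply: place1. Qed.

Lemma place_unitX u k : U u -> U (u ^+ k).
Proof. by move=> Uu; elim: k => [|k IH]; [apply: place_unit1 | rewrite exprS; apply: place_unitM]. Qed.

Lemma place_unit_const a : a != 0 -> U (iota a).
Proof. by move=> a0; split; rewrite ?fmorph_eq0 // -?fmorphV; apply: OF. Qed.

Lemma max_ideal_mul u v : M u -> O v -> M (u * v).
Proof.
move=> [Ou nu] Ov; split=> [|uv0 Ouv]; first exact: OM.
have /andP[u0 v0] : (u != 0) && (v != 0) by rewrite -negb_or -mulf_eq0.
apply: (nu u0); have -> : u^-1 = v * (u * v)^-1 by field; rewrite u0 v0.
exact: OM.
Qed.

(** By the valuation property one of u, v divides the other, and then it divides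
    their difference. *)
Lemma max_idealB u v : M u -> M v -> M (u - v).
Proof.
wlog Ouv : u v / exists2 w, O w & u = v * w.
  move=> IH Mu Mv; have [v0|v0] := eqVneq v 0; first by rewrite v0 subr0.
  have [u0|u0] := eqVneq u 0.
    apply: IH => //; exists 0; [exact: place0 | by rewrite u0 mulr0].
  have [Ow|Ow] := place_valuation hO (mulf_neq0 u0 (invr_neq0 v0)).
    by apply: IH => //; exists (u / v) => //; field.
  have MN w : M w -> M (- w).
    by move=> Mw; rewrite -mulrN1; apply: max_ideal_mul => //; apply/placeN/place1.
  rewrite -opprB; apply: MN; apply: IH => //; exists (u / v)^-1 => //.
  by field; rewrite u0 v0.
move: Ouv => [w Ow ->] _ Mv; rewrite -{2}[v]mulr1 -mulrBr; apply: max_ideal_mul => //.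
by apply: OB => //; apply: place1.
Qed.

Lemma max_idealN u : M u -> M (- u).
Proof. by move=> Mu; rewrite -sub0r; apply: (max_idealB max_ideal0). Qed.

Lemma max_idealD u v : M u -> M v -> M (u + v).
Proof. by move=> Mu Mv; rewrite -[v]opprK; apply: max_idealB => //; apply: max_idealN. Qed.

Lemma place_unitD u v : U u -> M v -> U (u + v).
Proof.
move=> Uu Mv; have Ouv : O (u + v) by apply: placeD; [apply: place_unit_sub | apply: max_ideal_sub].
have [|//] := place_cases Ouv; by move=> /max_idealB/(_ Mv); rewrite addrK => /max_ideal_nunit.
Qed.

Lemma place_unitN u : U u -> U (- u).
Proof. move=> [u0 Ou Oui]; by split; rewrite ?oppr_eq0 ?invrN //; apply: placeN. Qed.

Lemma max_ideal_unit u v : U u -> M (u * v) -> M v.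
Proof.
move=> [u0 Ou Oui] /max_ideal_mul/(_ Oui); rewrite mulrAC divff // mul1r //.
Qed.

Lemma max_ideal_prime u v : O u -> O v -> M (u * v) -> M u \/ M v.
Proof.
by move=> Ou Ov; have [?|Uu] := place_cases Ou; [left | move/(max_ideal_unit Uu); right].
Qed.

Lemma place_root k u : (0 < k)%N -> O (u ^+ k) -> O u.
Proof.
move=> k_gt0 Ouk; have [->|u0] := eqVneq u 0; first exact: place0.
have [//|Oui] := place_valuation hO u0.
have -> : u = u ^+ k * u^-1 ^+ k.-1; last by apply: OM => //; apply: placeX.
by rewrite -{1}(prednK k_gt0) exprSr exprVn mulrAC divff ?mul1r ?expf_neq0.
Qed.

Lemma max_ideal_root k u : (0 < k)%N -> M (u ^+ k) -> M u.
Proof.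
move=> k_gt0 Muk; have [//|Uu] := place_cases (place_root k_gt0 (max_ideal_sub Muk)).
by have := max_ideal_nunit Muk (place_unitX k Uu).
Qed.

Lemma max_idealX k u : (0 < k)%N -> M u -> M (u ^+ k).
Proof.
move=> k_gt0 Mu; rewrite -(prednK k_gt0) exprS; apply: max_ideal_mul => //.
exact/placeX/max_ideal_sub.
Qed.

Lemma place_unit_root k u : (0 < k)%N -> U (u ^+ k) -> U u.
Proof.
move=> k_gt0 Uuk; have [Mu|//] := place_cases (place_root k_gt0 (place_unit_sub Uuk)).
by have := max_ideal_nunit (max_idealX k_gt0 Mu) Uuk.
Qed.

Lemma place_pole z : ~ O z -> M z^-1.
Proof.
move=> nz; have z0 : z != 0 by apply: contra_not_neq nz => ->; apply: place0.
by have [//|Oz] := place_valuation hO z0; split; rewrite ?invrK.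
Qed.

(** A polynomial relation with constant coefficients forces a residue in F:
    the factors of the polynomial cannot all be units. *)
Lemma max_ideal_prod_XsubC (rs : seq F) z : O z ->
  M (\prod_(r <- rs) (z - iota r)) -> exists2 r, r \in rs & M (z - iota r).
Proof.
move=> Oz; elim: rs => [|r rs IH].
  by rewrite big_nil => /max_ideal_nunit []; apply: place_unit1.
rewrite big_cons => /max_ideal_prime[]; first exact: OB.
- by elim/big_ind: _ => [|? ?|? _]; [apply: place1 | apply: OM | apply: OB].
- by exists r; rewrite ?mem_head.
- by move/IH => [s s_rs Ms]; exists s; rewrite // inE s_rs orbT.
Qed.

End Place.

(** * Existence of places *)

Section Existence.
Variables (F K : fieldType) (iota : {rmorphism F -> K}) (R : K -> Prop) (pi : K).
Hypotheses (RF : forall a, R (iota a)).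
Hypotheses (RB : forall u v, R u -> R v -> R (u - v)).
Hypotheses (RM : forall u v, R u -> R v -> R (u * v)).
Hypotheses (pi0 : pi != 0) (Rpi : R pi) (nRpi : ~ R pi^-1).

Let good (S : classical_sets.set K) := [/\ (forall u, R u -> S u), (forall u v, S u -> S v -> S (u - v)),
  (forall u v, S u -> S v -> S (u * v)) & ~ S pi^-1].

Section Maximal.
Variable S : classical_sets.set K.
Hypothesis gS : good S.
Hypothesis maxS : forall T : classical_sets.set K,
  (forall u, S u -> T u) -> good T -> forall u, T u -> S u.

Let S0 : S 0. Proof. by case: gS => RS _ _ _; apply: RS; rewrite -(rmorph0 iota). Qed.
Let S1 : S 1. Proof. by case: gS => RS _ _ _; apply: RS; rewrite -(rmorph1 iota). Qed.
Let SB u v : S u -> S v -> S (u - v). Proof. by case: gS => _ + _ _; apply. Qed.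
Let SM u v : S u -> S v -> S (u * v). Proof. by case: gS => _ _ + _; apply. Qed.
Let SD u v : S u -> S v -> S (u + v).
Proof. by move=> Su Sv; rewrite -[v]opprK; apply: SB => //; rewrite -sub0r; apply: SB. Qed.
Let SX u k : S u -> S (u ^+ k).
Proof. by move=> Su; elim: k => [|k IH]; rewrite ?exprS //; apply: SM. Qed.
Let Spi : S pi. Proof. by case: gS => RS _ _ _; apply: RS. Qed.
Let nSpi : ~ S pi^-1. Proof. by case: gS. Qed.
Let Ssum I (r : seq I) (P : pred I) (g : I -> K) :
  (forall i, P i -> S (g i)) -> S (\sum_(i <- r | P i) g i).
Proof. by move=> Sg; apply: big_ind. Qed.

Let polyS (q : {poly K}) := forall i, S q`_i.

Let adjoin_pi z : ~ S z -> exists2 q, polyS q & q.[z] = pi^-1.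
Proof.
move=> nSz; apply: contrapT => nq; apply: nSz.
apply: (maxS (T := fun w => exists2 q, polyS q & q.[z] = w)).
- by move=> u Su; exists u%:P; rewrite ?hornerC // => i; rewrite coefC; case: ifP.
- have inS u : S u -> exists2 q, polyS q & q.[z] = u.
    by move=> Su; exists u%:P; rewrite ?hornerC // => i; rewrite coefC; case: ifP.
  split=> [u Ru|u v [q Sq <-] [r Sr <-]|u v [q Sq <-] [r Sr <-]|//].
  + by apply: inS; case: gS => RS _ _ _; apply: RS.
  + by exists (q - r); rewrite ?hornerE // => i; rewrite coefB; apply: SB.
  + by exists (q * r); rewrite ?hornerE // => i; rewrite coefM; apply: Ssum => k _; apply: SM.
- by exists 'X; rewrite ?hornerX // => i; rewrite coefX; case: (i == 1%N).
Qed.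

(** By maximality, [pi] lies in the Jacobson radical of [S]. *)
Let one_sub b : S b -> 1 - pi * b != 0 /\ S (1 - pi * b)^-1.
Proof.
move=> Sb; set u := 1 - pi * b.
have npi c : S c -> pi * c = 1 -> False.
  by move=> Sc E; apply: nSpi; rewrite -[pi^-1]mulr1 -E mulrA mulVf // mul1r.
have u0 : u != 0.
  by apply/eqP => /eqP; rewrite subr_eq0 eq_sym => /eqP; apply: npi.
split=> //; apply: contrapT => /adjoin_pi[q Sq qE].
have [s Ss us] : exists2 s, S s & u ^+ size q = 1 - pi * s.
  elim: (size q) => [|k [s Ss sE]]; first by exists 0; rewrite // mulr0 subr0.
  exists (b + s - pi * b * s); first by apply: SB; [apply: SD | do 2 apply: SM => //].
  by rewrite exprS sE /u; ring.
have Su : S u by apply: SB => //; apply: SM.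
apply: (npi (s + \sum_(i < size q) q`_i * u ^+ (size q - i))).
  by apply: SD => //; apply: Ssum => i _; apply: SM => //; apply: SX.
rewrite mulrDr -[1](subrK (pi * s)) -us addrC; congr (_ + _).
have -> : u ^+ size q = pi * (pi^-1 * u ^+ size q) by rewrite mulrA divff ?mul1r.
congr (_ * _); rewrite -qE horner_coef mulr_suml; apply: eq_bigr => i _.
rewrite -mulrA; congr (_ * _); apply: (mulfI (expf_neq0 i u0)).
by rewrite -exprD subnKC ?(ltnW (ltn_ord i)) // exprVn mulVKf ?expf_neq0.
Qed.

(** If neither z nor its inverse is in [S], maximality writes 1/pi as a polynomial
    in z and as a polynomial in 1/z.  The one of lower degree allows one to
    eliminate the leading term of the other, since 1 - pi b is a unit. *)
Let descent N z (q r : {poly K}) : (size q + size r <= N)%N -> z != 0 ->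
  polyS q -> polyS r -> q.[z] = pi^-1 -> r.[z^-1] = pi^-1 -> False.
Proof.
elim: N z q r => [|N IHN] z q r le_N z0 Sq Sr qE rE.
  move: le_N; rewrite leqn0 addn_eq0 => /andP[]; rewrite size_poly_eq0 => /eqP q0 _.
  by apply: nSpi; rewrite -qE q0 horner0.
wlog le_rq : z q r z0 Sq Sr qE rE le_N / (size r <= size q)%N.
  move=> IH; have [|/ltnW le_qr] := leqP (size r) (size q); first exact: (IH z).
  by apply: (IH z^-1 r q); rewrite ?invr_eq0 ?invrK // addnC.
have [u0 Sui] := one_sub (Sr 0%N); set u := 1 - _ in u0 Sui.
case sq: (size q) => [|k].
  by move/eqP: sq; rewrite size_poly_eq0 => /eqP q0; apply: nSpi; rewrite -qE q0 horner0.
case sr: (size r) => [|l].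
  by move/eqP: sr; rewrite size_poly_eq0 => /eqP q0; apply: nSpi; rewrite -rE q0 horner0.
have le_lk : (l <= k)%N by rewrite -ltnS -sr -sq.
have zk : z ^+ k = \sum_(j < l) pi * u^-1 * r`_j.+1 * z ^+ (k - j.+1).
  have uE : u = pi * \sum_(j < l) r`_j.+1 * z^-1 ^+ j.+1.
    move: rE; rewrite horner_coef sr big_ord_recl expr0 mulr1 => rE.
    rewrite /u -{1}(mulfV pi0) -rE mulrDr addrC addKr; congr (_ * _).
  have -> : z ^+ k = u^-1 * (u * z ^+ k) by rewrite mulrA mulVf ?mul1r.
  rewrite {2}uE -mulrA mulr_suml !mulr_sumr; apply: eq_bigr => j _.
  have jk : (j.+1 <= k)%N by apply: leq_trans le_lk.
  rewrite -{1}(subnK jk) exprD exprVn; field.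
  by rewrite u0 expf_neq0.
pose q' := \poly_(i < k) q`_i + \sum_(j < l) (q`_k * (pi * u^-1 * r`_j.+1)) *: 'X^(k - j.+1).
apply: (IHN z q' r) => //.
- rewrite -ltnS (leq_trans _ le_N) // ltn_add2r sq ltnS.
  apply: (leq_trans (size_polyD _ _)); rewrite geq_max size_poly /=.
  apply: (leq_trans (size_sum _ _ _)); apply/bigmax_leqP => j _.
  apply: (leq_trans (size_scale_leq _ _)); rewrite size_polyXn.
  by rewrite ltn_subrL /= (leq_trans _ le_lk) // (leq_trans _ (ltn_ord j)).
- move=> i; rewrite coefD coef_poly; apply: SD; first by case: ifP.
  rewrite coef_sum; apply: Ssum => j _; rewrite coefZ coefXn; apply: SM.
    by apply: SM => //; apply: SM => //; apply: SM.
  by case: (i == _).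
- rewrite -qE !hornerE [in RHS]horner_coef sq big_ord_recr /= horner_poly; congr (_ + _).
  rewrite horner_sum zk mulr_sumr; apply: eq_bigr => j _.
  by rewrite hornerZ hornerXn /= !mulrA.
Qed.

Lemma maximal_place : place iota S.
Proof.
split=> //.
- by move=> a; case: gS => RS _ _ _; apply: RS.
- by exists pi^-1.
move=> z z0; have [|nz] := EM (S z); [by left | right].
apply: contrapT => nzi; have [q Sq qE] := adjoin_pi nz.
by have [r Sr rE] := adjoin_pi nzi; apply: (descent (leqnn _) z0 Sq Sr).
Qed.
End Maximal.

(** Chevalley's extension theorem: the subrings of K that contain R but not 1/pi
    have maximal elements by Zorn's lemma, and these are valuation rings. *)
Lemma place_exists : exists O, [/\ place iota O, max_ideal O pi & forall u, R u -> O u].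
Proof.
pose P (S : classical_sets.set K) := S = classical_sets.set0 \/ good S.
have [Fs FP tot|S [PS maxS]] := @classical_sets.Zorn_bigcup K P.
  have [[T FT gT]|noT] := EM (exists2 T, Fs T & good T); last first.
    left; apply/classical_sets.seteqP; split=> // u [T FT Tu]; have [T0|gT] := FP _ FT.
      by move: Tu; rewrite T0.
    by case: noT; exists T.
  have common u v : (classical_sets.bigcup Fs id) u -> (classical_sets.bigcup Fs id) v ->
      exists X, [/\ Fs X, X u, X v & good X].
    move=> [X FX Xu] [Y FY Yv].
    have gX Z w : Fs Z -> Z w -> good Z.
      by move=> FZ Zw; case: (FP _ FZ) => // Z0; move: Zw; rewrite Z0.
    have [XY|YX] := tot X Y FX FY.
      by exists Y; split=> //; [apply: XY | apply: gX Yv].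
    by exists X; split=> //; [apply: YX | apply: gX Xu].
  right; split=> [u Ru|u v uS vS|u v uS vS|].
  - by exists T => //; case: gT => RT _ _ _; apply: RT.
  - by have [X [FX Xu Xv [_ XB _ _]]] := common u v uS vS; exists X => //; apply: XB.
  - by have [X [FX Xu Xv [_ _ XM _]]] := common u v uS vS; exists X => //; apply: XM.
  - by move=> piS; have [X [_ Xpi _ [_ _ _]]] := common _ _ piS piS.
have gR : good R by split.
have gS : good S.
  case: PS => // S0; case: (maxS R); last by right.
  by rewrite S0; split=> [u []|E]; have := E pi Rpi.
have pl : place iota S.
  apply: maximal_place gS _ => T ST gT u Tu; apply: contrapT => nSu.
  case: (maxS T); last by right.
  by split=> // TS; apply: nSu; apply: TS.
case: (gS) => RS _ _ nS.
by exists S; split=> //; split=> //; apply: RS.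
Qed.
End Existence.

(** * Local parameters at a smooth point *)

(** A local parameter [t] for which [d/dt] is defined and preserves the valuation
    ring; regularity of [f dx] at [O] then means that [f / D t] is in [O]. *)
Definition good_parameter (K : fieldType) (D : K -> K) (O : K -> Prop) (t : K) :=
  [/\ local_parameter O t, D t != 0 & forall z, O z -> O (D z / D t)].

Section SmoothPoint.
Variables (F K : fieldType) (iota : {rmorphism F -> K}) (D : {additive K -> K}).
Hypothesis DM : forall u v, D (u * v) = D u * v + u * D v.
Hypothesis DF : forall a, D (iota a) = 0.
Variables (O : K -> Prop) (s w t : K) (s0 w0 : F) (us uw as_ aw : K).
Hypothesis hO : place iota O.
Local Notation A := (adjoin iota s w).
Local Notation M := (max_ideal O).
Local Notation U := (place_unit O).
Hypotheses (Os : O s) (Ow : O w).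
Hypothesis frac : forall z, exists a b, [/\ A a, A b, b != 0 & z = a / b].
Hypotheses (At : A t) (Mt : M t).
Hypotheses (Aus : A us) (Aas : A as_) (Uus : U us) (Es : us * (s - iota s0) = t * as_).
Hypotheses (Auw : A uw) (Aaw : A aw) (Uuw : U uw) (Ew : uw * (w - iota w0) = t * aw).
Hypothesis separated : forall a, A a -> a != 0 -> exists k, forall z, O z -> a != t ^+ k * z.
Hypotheses (Dt0 : D t != 0) (DsO : O (D s / D t)) (DwO : O (D w / D t)).

Lemma adjoin_place a : A a -> O a.
Proof.
elim=> // [a'|u v _ Ou _ Ov|u v _ Ou _ Ov]; first exact: (place_const hO).
  exact: (place_sub hO).
exact: (place_mul hO).
Qed.

(** The ring F[s, w] is the sum of F and of the multiples of [t], up to units. *)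
Let residue a : A a -> exists c u a', [/\ A u, A a', U u & u * (a - iota c) = t * a'].
Proof.
elim=> [c|||u v Au [c [r [a' [Ar Aa Ur rE]]]] Av [c2 [r2 [a2 [Ar2 Aa2 Ur2 rE2]]]]
         |u v Au [c [r [a' [Ar Aa Ur rE]]]] Av [c2 [r2 [a2 [Ar2 Aa2 Ur2 rE2]]]]].
- exists c, 1, 0; rewrite subrr !mulr0.
  split=> //; [exact: adjoin1 | exact: adjoin0 | exact: (place_unit1 hO)].
- by exists s0, us, as_.
- by exists w0, uw, aw.
- exists (c - c2), (r * r2), (r2 * a' - r * a2); split.
  + exact: adjoin_mul.
  + by apply: adjoin_sub; apply: adjoin_mul.
  + exact: (place_unitM hO).
  + rewrite rmorphB; transitivity (r2 * (r * (u - iota c)) - r * (r2 * (v - iota c2))); first ring.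
    by rewrite rE rE2; ring.
- exists (c * c2), (r * r2), (r2 * a' * v + r * iota c * a2); split.
  + exact: adjoin_mul.
  + by apply: adjoin_add; apply: adjoin_mul => //; apply: adjoin_mul => //; apply: adjoin_const.
  + exact: (place_unitM hO).
  + rewrite rmorphM.
    transitivity (r2 * (r * (u - iota c)) * v + r * iota c * (r2 * (v - iota c2))); first ring.
    by rewrite rE rE2; ring.
Qed.

Let principal a : A a -> M a -> exists u a', [/\ A u, A a', U u & u * a = t * a'].
Proof.
move=> Aa Ma; have [c [u [a' [Au Aa' Uu E]]]] := residue Aa.
exists u, a'; split=> //; suff c0 : c = 0 by rewrite -E c0 rmorph0 subr0.
apply: contrapT => /eqP c0; have Uc := place_unit_const hO c0.
apply: (max_ideal_nunit _ Uc); rewrite -[iota c](subKr a); apply: (max_idealB hO) => //.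
apply: (max_ideal_unit hO Uu); rewrite E.
by apply: (max_ideal_mul hO) => //; apply: adjoin_place.
Qed.

Let factor_adj a : A a -> a != 0 ->
  exists k a' u, [/\ A a', A u, U a', U u & u * a = t ^+ k * a'].
Proof.
move=> Aa a0; have [N sepN] := separated Aa a0.
have [//|[u [a' [Au Aa' Uu E]]]] :
  (exists k a' u, [/\ A a', A u, U a', U u & u * a = t ^+ k * a'])
  \/ (exists u a', [/\ A u, A a', U u & u * a = t ^+ N * a']); last first.
  have u0 := place_unit_neq0 Uu.
  suff Oau : O (a' / u).
    by have /eqP[] := sepN _ Oau; rewrite mulrA -E mulrAC divff ?mul1r.
  by apply: (place_mul hO); [apply: adjoin_place | case: Uu].
elim: N {sepN} => [|k [IH|[u [a' [Au Aa' Uu E]]]]]; [|by left|].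
  right; exists 1, a; rewrite expr0; split=> //; [exact: adjoin1 | exact: (place_unit1 hO)].
have [Ma|Ua] := place_cases hO (adjoin_place Aa'); last by left; exists k, a', u.
have [v [b [Av Ab Uv vE]]] := principal Aa' Ma.
right; exists (v * u), b; split=> //; [exact: adjoin_mul | exact: (place_unitM hO)|].
by rewrite -mulrA E mulrCA vE exprS; ring.
Qed.

Let t0 : t != 0.
Proof. by apply: contraNneq Dt0 => ->; rewrite raddf0. Qed.

Let factor z : z != 0 -> exists k a u, [/\ A a, A u, U a, U u &
  z = t ^+ k * (a / u) \/ a / u = t ^+ k * z].
Proof.
have [a [b [Aa Ab b0 ->]]] := frac z; rewrite mulf_eq0 invr_eq0 negb_or => /andP[a0 _].
have [k [a' [u [Aa' Au Ua' Uu E]]]] := factor_adj Aa a0.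
have [l [b' [v [Ab' Av Ub' Uv E']]]] := factor_adj Ab b0.
have [u0 v0] := (place_unit_neq0 Uu, place_unit_neq0 Uv).
have b'0 := place_unit_neq0 Ub'.
have aE : a = t ^+ k * a' / u by rewrite -E mulrAC divff ?mul1r.
have bE : b = t ^+ l * b' / v by rewrite -E' mulrAC divff ?mul1r.
have [le_lk|/ltnW le_kl] := leqP l k; [exists (k - l)%N|exists (l - k)%N];
  exists (a' * v), (b' * u); split; try exact: adjoin_mul; try exact: (place_unitM hO).
  left; rewrite aE bE -{1}(subnK le_lk) exprD; field.
  by rewrite u0 v0 b'0 expf_neq0.
right; rewrite aE bE -{2}(subnK le_kl) exprD; field.
by rewrite u0 v0 b'0 !expf_neq0.
Qed.

Let place_frac z : O z -> exists a u, [/\ A a, A u, U u & z = a / u].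
Proof.
move=> Oz; have [->|z0] := eqVneq z 0.
  by exists 0, 1; rewrite mul0r; split=> //; [exact: adjoin0|exact: adjoin1|exact: (place_unit1 hO)].
have [[|k] [a [u [Aa Au Ua Uu]]]] := factor z0.
  by rewrite expr0 !mul1r => -[|/esym] ?; exists a, u.
case=> [->|E].
  by exists (t ^+ k.+1 * a), u; rewrite mulrA; split=> //; apply: adjoin_mul => //; apply: adjoinX.
have := max_ideal_mul hO (max_idealX hO (ltn0Sn k) Mt) Oz; rewrite -E.
by move/max_ideal_nunit; case; apply: (place_unitM hO) => //; apply: place_unitV.
Qed.

(** The hypotheses on [us] and [uw] say that [t] generates the ideal of the point
    [(s0, w0)] in the local ring of F[s, w].  An element of that ring that is not a
    unit is thus t times another one; by separatedness this can only be repeated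
    finitely often, so every z in K is a power of t times a unit of the local
    ring.  Therefore O is this local ring, and d/dt preserves it because it maps
    the generators s and w into it. *)
Lemma smooth_point_parameter : good_parameter D O t.
Proof.
split=> // [z|z].
  split=> [Mz|[u Ou ->]]; last by rewrite mulrC; apply: (max_ideal_mul hO).
  have [->|z0] := eqVneq z 0; first by exists 0; [exact: (place0 hO) | rewrite mul0r].
  have [k [a [u [Aa Au Ua Uu E]]]] := factor z0.
  have Uau : U (a / u) by apply: (place_unitM hO) => //; apply: place_unitV.
  case: E => E.
    case: k E => [|k] E.
      by case: (max_ideal_nunit Mz); rewrite E expr0 mul1r.
    exists (t ^+ k * (a / u)); last by rewrite E exprS; ring.
    by apply: (place_mul hO); [apply: (placeX hO); case: Mt | case: Uau].
  case: (@max_ideal_nunit _ O (a / u)) => //; rewrite E mulrC.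
  by apply: (max_ideal_mul hO) => //; apply: (placeX hO); case: Mt.
move=> /place_frac[a [u [Aa Au Uu ->]]].
have DA b : A b -> O (D b / D t).
  elim=> // [c|b1 b2 Ab1 IH1 Ab2 IH2|b1 b2 Ab1 IH1 Ab2 IH2].
  - by rewrite DF mul0r; apply: (place0 hO).
  - by rewrite raddfB mulrBl; apply: (place_sub hO).
  - rewrite DM mulrDl mulrAC -[b1 * _ / _]mulrA; apply: (placeD hO).
      by apply: (place_mul hO) => //; apply: adjoin_place.
    by apply: (place_mul hO) => //; apply: adjoin_place.
have u0 := place_unit_neq0 Uu; rewrite (derivation_div DM) //.
have -> : (D a * u - a * D u) / u ^+ 2 / D t = u^-1 ^+ 2 * ((D a / D t) * u - a * (D u / D t)).
  by field; rewrite u0 Dt0.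
have [_ Ou Oui] := Uu.
apply: (place_mul hO); first exact: (placeX hO).
by apply: (place_sub hO); apply: (place_mul hO) => //; [apply: DA|apply: adjoin_place|apply: DA].
Qed.
End SmoothPoint.

(** * The action of the roots of unity *)

Section Places.
Variables (m n : nat) (F : closedFieldType) (K : fieldType).
Variables (iota : {rmorphism F -> K}) (x y : K).
Hypothesis hK : function_field_of iota (Fmn_poly F m n) x y.
Hypotheses (m_gt0 : (0 < m)%N) (n_gt0 : (0 < n)%N).
Hypotheses (mF : m%:R != 0 :> F) (nF : n%:R != 0 :> F).
Variable D : {additive K -> K}.
Hypothesis DM : forall u v, D (u * v) = D u * v + u * D v.
Hypothesis DF : forall a, D (iota a) = 0.
Hypothesis Dx : D x = 1.
Variables (zeta : F) (sg : nat -> {rmorphism K -> K}).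
Hypothesis zetaP : m.-primitive_root zeta.
Hypothesis sgF : forall k a, sg k (iota a) = iota a.
Hypothesis sgx : forall k, sg k x = x.
Hypothesis sgy : forall k, sg k y = iota (zeta ^+ k) * y.

Local Notation A := (adjoin iota x y).
Local Notation px P := (map_poly iota P).[x].
Let yE := curve_eq hK.
Let x0 : x != 0 := x_neq0 hK m_gt0.
Let y0 : y != 0 := y_neq0 hK m_gt0 n_gt0.
Let mK0 : m%:R != 0 :> K := natr_image_neq0 iota mF.
Let nK0 : n%:R != 0 :> K := natr_image_neq0 iota nF.
Let pxP P : P != 0 -> px P != 0 := @x_transcendental m n F K iota x y hK m_gt0 P.

Lemma derivation_y : D y = n%:R * x ^+ n.-1 / (m%:R * y ^+ m.-1).
Proof.
have /eqP := congr1 D yE; rewrite raddfD /= !derivation_exp // derivation1 // Dx addr0 mulr1.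
rewrite -[X in X == _ -> _]mulr_natl -[X in _ == X -> _]mulr_natl => /eqP E.
by rewrite -E; field; rewrite mK0 expf_neq0.
Qed.

Lemma sg_comp j k z : sg (j + k) z = sg j (sg k z).
Proof.
elim/(function_field_ind hK): z => [a||| u v IHu IHv | u v IHu IHv | u _ IHu].
- by rewrite !sgF.
- by rewrite !sgx.
- by rewrite !sgy rmorphM sgF sgy exprD mulrC rmorphM; ring.
- by rewrite !rmorphB IHu IHv.
- by rewrite !rmorphM IHu IHv.
- by rewrite !fmorphV IHu.
Qed.

Lemma sg_period z : sg m z = z.
Proof.
elim/(function_field_ind hK): z => [a||| u v IHu IHv | u v IHu IHv | u _ IHu].
- by rewrite sgF.
- by rewrite sgx.
- by rewrite sgy (prim_expr_order zetaP) rmorph1 mul1r.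
- by rewrite rmorphB IHu IHv.
- by rewrite rmorphM IHu IHv.
- by rewrite fmorphV IHu.
Qed.

Lemma sg0 z : sg 0 z = z.
Proof. by apply: (fmorph_inj (sg m)); rewrite -sg_comp addn0. Qed.

(** The orbit of z has period m, so the inverse of [sg k] is one of its powers. *)
Lemma sg_surj k z : exists w, sg k w = z.
Proof.
exists (sg (k * m.-1) z); rewrite -sg_comp -mulnS prednK // mulnC.
elim: k => [|k IH]; first by rewrite muln0 sg0.
by rewrite mulnS sg_comp IH sg_period.
Qed.

Lemma sg_D k z : D (sg k z) = sg k (D z).
Proof.
elim/(function_field_ind hK): z => [a||| u v IHu IHv | u v IHu IHv | u u0 IHu].
- by rewrite sgF !DF rmorph0.
- by rewrite sgx Dx rmorph1.
- have Z0 : iota (zeta ^+ k) != 0.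
    by rewrite fmorph_eq0 expf_neq0 // (prim_root_eq0 zetaP) -lt0n.
  have Zm : iota (zeta ^+ k) ^+ m = 1.
    by rewrite -rmorphXn -exprM mulnC exprM (prim_expr_order zetaP) expr1n rmorph1.
  have DZ : D (iota (zeta ^+ k) * y) = iota (zeta ^+ k) * D y.
    by rewrite DM DF mul0r add0r.
  move: (sgy k) Z0 Zm DZ; set Z := iota _ => sgZ Z0 Zm DZ.
  have ZE : Z = (Z ^+ m.-1)^-1.
    by apply: (mulIf (expf_neq0 m.-1 Z0)); rewrite mulVf ?expf_neq0 // -exprS prednK.
  rewrite sgZ DZ derivation_y fmorph_div !rmorphM !rmorphXn !rmorph_nat sgx sgZ exprMn {1}ZE.
  by field; rewrite !expf_neq0 ?mK0.
- by rewrite !raddfB /= IHu IHv.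
- by rewrite rmorphM DM IHu IHv -!rmorphM -rmorphD -DM.
- by rewrite fmorphV !(derivationV DM) ?fmorph_eq0 // IHu rmorphN fmorph_div rmorphXn.
Qed.

Lemma sg_fixed z : sg 1 z = z -> forall k, sg k z = z.
Proof.
move=> E; elim=> [|k IH]; first exact: sg0.
by rewrite -addn1 sg_comp E.
Qed.

Let fixed_prod z k : sg k (\prod_(i < m) sg i z) = \prod_(i < m) sg i z.
Proof.
apply: sg_fixed; rewrite rmorph_prod -(prednK m_gt0) big_ord_recr big_ord_recl /= mulrC.
rewrite -sg_comp add1n prednK // sg_period sg0; congr (_ * _).
by apply: eq_bigr => i _; rewrite -sg_comp add1n.
Qed.

(** Summing over the group kills y^j unless m divides j, and y^m is a polynomial
    in x. *)
Let sum_adjoin a : A a -> exists P, \sum_(k < m) sg k a = px P.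
Proof.
move=> /adjoinP[Q ->]; under eq_bigr => k _ do rewrite ev_sum rmorph_sum.
have sumP I (r : seq I) (g : I -> K) :
    (forall i, exists P, g i = px P) -> exists P, \sum_(i <- r) g i = px P.
  move=> gP; elim: r => [|i r [P IH]]; first by exists 0; rewrite big_nil rmorph0 horner0.
  have [R gR] := gP i; exists (R + P).
  by rewrite big_cons IH gR rmorphD hornerD.
rewrite exchange_big; apply: (sumP _ _ _) => i.
under eq_bigr => k _ do rewrite rmorph_sum.
rewrite exchange_big; apply: (sumP _ _ _) => j.
set c := Q`_i`_j; have -> : \sum_(k < m) sg k (iota c * y ^+ j * x ^+ i) =
    iota (c * \sum_(k < m) zeta ^+ (k * j)) * y ^+ j * x ^+ i.
  rewrite rmorphM rmorph_sum mulr_sumr !mulr_suml; apply: eq_bigr => k _.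
  by rewrite !rmorphM !rmorphXn sgF sgy sgx exprM !rmorphXn exprMn; ring.
rewrite prim_root_sum //; case: ifP => [/dvdnP[l ->]|_]; last first.
  by exists 0; rewrite mulr0 !rmorph0 !mul0r horner0.
exists ((c * m%:R)%:P * ('X^n + 1) ^+ l * 'X^i).
rewrite mulnC exprM yE !rmorphM !rmorphXn rmorphD rmorph1 rmorphXn /= map_polyX !map_polyC.
by rewrite !hornerE ?rmorphM.
Qed.

Let fixed_adjoin a : A a -> (forall k, sg k a = a) -> exists P, a = px P.
Proof.
move=> /sum_adjoin[P E] fa; exists (m%:R^-1 *: P).
rewrite map_polyZ hornerZ -E; under eq_bigr => k _ do rewrite fa.
rewrite sumr_const card_ord /= fmorphV rmorph_nat.
by rewrite -[a *+ m]mulr_natl mulKf.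
Qed.

Let cofactor z := \prod_(i < m.-1) sg i.+1 z.

Let norm_cofactor z : z * cofactor z = \prod_(i < m) sg i z.
Proof.
rewrite /cofactor; case: (m) m_gt0 => // k _.
by rewrite big_ord_recl sg0.
Qed.

Let norm_neq0 z : z != 0 -> z * cofactor z != 0.
Proof.
move=> z0; rewrite norm_cofactor; apply/prodf_neq0 => i _.
by rewrite fmorph_eq0.
Qed.

Let cofactor_neq0 z : z != 0 -> cofactor z != 0.
Proof. by move/norm_neq0; rewrite mulf_eq0 negb_or => /andP[]. Qed.

Lemma sg_adjoin s w k a : (exists c, sg k s = iota c * s) -> (exists c, sg k w = iota c * w) ->
  adjoin iota s w a -> adjoin iota s w (sg k a).
Proof.
move=> [c sE] [c' wE]; elim=> [b|||u v _ IHu _ IHv|u v _ IHu _ IHv].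
- by rewrite sgF; apply: adjoin_const.
- by rewrite sE; apply: adjoin_mul; [apply: adjoin_const | apply: adjoin_l].
- by rewrite wE; apply: adjoin_mul; [apply: adjoin_const | apply: adjoin_r].
- by rewrite rmorphB; apply: adjoin_sub.
- by rewrite rmorphM; apply: adjoin_mul.
Qed.

Let cofactor_adjoin s w a : (forall k, exists c, sg k s = iota c * s) ->
  (forall k, exists c, sg k w = iota c * w) ->
  adjoin iota s w a -> adjoin iota s w (cofactor a).
Proof. by move=> sE wE Aa; apply: adjoin_bigprod => i _; apply: sg_adjoin. Qed.

Let sgx_scale k : exists c, sg k x = iota c * x.
Proof. by exists 1; rewrite sgx rmorph1 mul1r. Qed.
Let sgy_scale k : exists c, sg k y = iota c * y.
Proof. by exists (zeta ^+ k). Qed.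

(** Multiplying the denominator of z by its conjugates makes it a polynomial in x;
    the numerator becomes an invariant element of F[x, y], hence a polynomial in
    x as well. *)
Lemma fixed_ratio z : (forall k, sg k z = z) ->
  exists P Q, [/\ Q != 0, coprimep P Q & z = px P / px Q].
Proof.
move=> fz; have [a [b [Aa Ab b0 zE]]] := function_field_frac hK z.
have Ac := cofactor_adjoin sgx_scale sgy_scale Ab.
have [Q QE] : exists Q, b * cofactor b = px Q.
  by apply: fixed_adjoin => [|k]; [apply: adjoin_mul | rewrite norm_cofactor fixed_prod].
have [P PE] : exists P, a * cofactor b = px P.
  apply: fixed_adjoin => [|k]; first exact: adjoin_mul.
  have -> : a * cofactor b = z * (b * cofactor b) by rewrite zE; field.
  by rewrite rmorphM fz QE -QE norm_cofactor fixed_prod.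
have Q0 : Q != 0.
  by apply: contraNneq (norm_neq0 b0) => Q0; rewrite QE Q0 rmorph0 horner0.
have zPQ : z = px P / px Q.
  by rewrite -QE -PE zE; field; rewrite b0 cofactor_neq0.
have Pd : P = (P %/ gcdp P Q) * gcdp P Q by rewrite divpK ?dvdp_gcdl.
have Qd : Q = (Q %/ gcdp P Q) * gcdp P Q by rewrite divpK ?dvdp_gcdr.
have g0 : gcdp P Q != 0 by rewrite gcdp_eq0 (negPf Q0) andbF.
have Q'0 : Q %/ gcdp P Q != 0 by apply: contraNneq Q0 => E; rewrite Qd E mul0r.
exists (P %/ gcdp P Q), (Q %/ gcdp P Q); split=> //.
  by rewrite coprimep_div_gcd // Q0 orbT.
have PE' : px P = px (P %/ gcdp P Q) * px (gcdp P Q) by rewrite -hornerM -rmorphM -Pd.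
have QE' : px Q = px (Q %/ gcdp P Q) * px (gcdp P Q) by rewrite -hornerM -rmorphM -Qd.
by rewrite zPQ PE' QE' -mulf_div divff ?mulr1 // pxP.
Qed.

(** The norm of z is invariant, and z divides it in any subring that
    contains z and is stable under the group. *)
Lemma norm_ratio z : z != 0 ->
  exists P Q, [/\ P != 0, Q != 0 & z * cofactor z = px P / px Q].
Proof.
move=> z0; have [|P [Q [Q0 _ E]]] := @fixed_ratio (z * cofactor z).
  by move=> k; rewrite norm_cofactor fixed_prod.
exists P, Q; split=> //; apply: contraNneq (norm_neq0 z0) => P0.
by rewrite E P0 rmorph0 horner0 mul0r.
Qed.

(** * Local parameters of the curve *)

Section AtPlace.
Variable O : K -> Prop.
Hypothesis hO : place iota O.
Local Notation M := (max_ideal O).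
Local Notation U := (place_unit O).

(** Here [pi] is x - a or 1/x and t^e is [pi] up to a unit.  A nonzero [a] divides
    its norm, a nonzero element of F(x), and so divides a power of [pi] in O;
    this bounds the powers of [t] that divide [a]. *)
Let separated s w t pi v e :
    (forall k, exists c, sg k s = iota c * s) -> (forall k, exists c, sg k w = iota c * w) ->
    (forall P, P != 0 -> exists l, O (pi ^+ l / px P)) ->
    (forall P, exists l, O (pi ^+ l * px P)) ->
    O s -> O w -> M t -> t != 0 -> U v -> pi * v = t ^+ e ->
  forall a, adjoin iota s w a -> a != 0 -> exists k, forall z, O z -> a != t ^+ k * z.
Proof.
move=> hs hw dP mP Os Ow Mt t0 Uv pv a Aa a0.
have [P [Q [P0 Q0 E]]] := norm_ratio a0.
have [l Ol] := dP P P0; have [l' Ol'] := mP Q.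
exists (e * (l + l')).+1 => z Oz; apply/eqP => aE.
have Oc : O (cofactor a) by apply: (adjoin_place hO Os Ow); apply: cofactor_adjoin.
have v0 := place_unit_neq0 Uv.
have [Px0 Qx0] := (pxP P0, pxP Q0).
have piE : pi ^+ (l + l') = a * cofactor a * (pi ^+ l / px P * (pi ^+ l' * px Q)).
  by rewrite E exprD; field; rewrite Px0 Qx0.
have : M (t * (z * cofactor a * (pi ^+ l / px P * (pi ^+ l' * px Q)) * v ^+ (l + l'))).
  apply: (max_ideal_mul hO) => //; apply: (place_mul hO); last first.
    by apply: (placeX hO); case: Uv.
  by apply: (place_mul hO); apply: (place_mul hO).
have -> : t * (z * cofactor a * (pi ^+ l / px P * (pi ^+ l' * px Q)) * v ^+ (l + l')) = 1.
  apply: (mulfI (expf_neq0 (e * (l + l')) t0)).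
  transitivity (t ^+ (e * (l + l')).+1 * z * cofactor a *
    (pi ^+ l / px P * (pi ^+ l' * px Q)) * v ^+ (l + l')).
    by rewrite exprS; ring.
  by rewrite -aE -piE -exprMn pv -exprM mulr1.
by move/max_ideal_nunit; apply; apply: (place_unit1 hO).
Qed.

Lemma residue_poly z r (P : {poly F}) : M (z - iota r) -> O z ->
  M ((map_poly iota P).[z] - iota P.[r]).
Proof.
move=> Mz Oz; have /factor_theorem[Q QE] : root (P - P.[r]%:P) r.
  by rewrite rootE !hornerE subrr.
have := congr1 (fun R => (map_poly iota R).[z]) QE.
rewrite rmorphB rmorphM rmorphB /= map_polyX !map_polyC !hornerE => ->.
rewrite mulrC; apply: (max_ideal_mul hO) => //.
rewrite horner_coef; apply: (place_bigsum hO) => i _.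
by apply: (place_mul hO); [rewrite coef_map; apply: (place_const hO) | apply: (placeX hO)].
Qed.

(** The polynomial splits over F, and O has a prime maximal ideal. *)
Lemma residue_root (P : {poly F}) z : P != 0 -> O z -> M (map_poly iota P).[z] ->
  exists2 r, root P r & M (z - iota r).
Proof.
move=> P0 Oz; have [rs PE] := closed_field_poly_normal P.
have lc0 : lead_coef P != 0 by rewrite lead_coef_eq0.
rewrite PE map_polyZ hornerZ => /(max_ideal_unit hO (place_unit_const hO lc0)).
rewrite rmorph_prod horner_prod.
under eq_bigr => r _ do rewrite rmorphB /= map_polyX map_polyC hornerXsubC.
move=> /(max_ideal_prod_XsubC hO Oz)[r r_rs Mr]; exists r => //.
by rewrite rootZ // root_prod_XsubC.
Qed.

(** At r the quotient (X^k - r^k) / (X - r) takes the value k r^(k-1), which is not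
    zero. *)
Let difference_quotient s w z r k : adjoin iota s w z -> O z -> M (z - iota r) ->
    r != 0 -> k%:R != 0 :> F ->
  exists q, [/\ adjoin iota s w q, U q & q * (z - iota r) = z ^+ k - iota r ^+ k].
Proof.
move=> Az Oz Mz r0 k0; pose P := \sum_(i < k) (r ^+ i) *: 'X^(k.-1 - i).
have PE (L : comNzRingType) (j : {rmorphism F -> L}) c :
    (map_poly j P).[c] = \sum_(i < k) c ^+ (k.-1 - i) * j r ^+ i.
  rewrite rmorph_sum horner_sum; apply: eq_bigr => i _.
  by rewrite /= map_polyZ hornerZ map_polyXn hornerXn mulrC rmorphXn.
exists (map_poly iota P).[z]; split.
- rewrite PE; apply: adjoin_bigsum => i _; apply: adjoin_mul; apply: adjoinX => //.
  exact: adjoin_const.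
- rewrite -[X in U X](subrK (iota P.[r])) addrC; apply: (place_unitD hO); last exact: residue_poly.
  apply: (place_unit_const hO); have := PE F idfun r; rewrite map_poly_id // => ->.
  rewrite (eq_bigr (fun _ => r ^+ k.-1)) => [|i _].
    by rewrite sumr_const card_ord -mulr_natr mulf_neq0 // expf_neq0.
  rewrite /= -exprD subnK // -ltnS prednK // (leq_ltn_trans _ (ltn_ord i)) //.
- by rewrite PE mulrC -subrXX.
Qed.

Section Finite.
Hypothesis Ox : O x.

Let Oy : O y.
Proof.
apply: (place_root hO m_gt0); rewrite yE.
by apply: (placeD hO); [apply: (placeX hO) | apply: (place1 hO)].
Qed.

Let Opx P : O (px P).
Proof.
rewrite horner_coef; apply: (place_bigsum hO) => i _.
by apply: (place_mul hO); [rewrite coef_map; apply: (place_const hO) | apply: (placeX hO)].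
Qed.

(** Otherwise every nonzero polynomial in x would be a unit of O; the norm of a
    nonzero element of F[x, y] would be one too, so O would be K. *)
Lemma finite_residue : exists a, M (x - iota a).
Proof.
apply: contrapT => nM; have Upx P : P != 0 -> U (px P).
  move=> P0; have [Mp|//] := place_cases hO (Opx P).
  by have [r _ Mr] := residue_root P0 Ox Mp; case: nM; exists r.
have [z] := place_proper hO; apply.
have [a [b [Aa Ab b0 ->]]] := function_field_frac hK z.
have [P [Q [P0 Q0 E]]] := norm_ratio b0.
have c0 := cofactor_neq0 b0.
have -> : a / b = a * cofactor b * (px Q / px P).
  rewrite -[px Q / px P]invrK invf_div -E; field.
  by rewrite b0 c0.
apply: (place_mul hO).
  by apply: (adjoin_place hO Ox Oy); apply: adjoin_mul => //; apply: cofactor_adjoin.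
by apply: (place_mul hO) => //; case: (Upx P P0).
Qed.

Variable a : F.
Hypothesis Ma : M (x - iota a).

Let divides_pi P : P != 0 -> exists l, O ((x - iota a) ^+ l / px P).
Proof.
move=> P0; have [l [R + PE]] := multiplicity_XsubC P a.
rewrite P0 /= => Ra; exists l.
have UR : U (px R).
  rewrite -[px R](subrK (iota R.[a])) addrC; apply: (place_unitD hO); last exact: residue_poly.
  exact: (place_unit_const hO).
rewrite PE rmorphM rmorphXn rmorphB /= map_polyX map_polyC hornerM horner_exp hornerXsubC.
have -> : (x - iota a) ^+ l / (px R * (x - iota a) ^+ l) = (px R)^-1.
  by field; rewrite (place_unit_neq0 UR) expf_neq0 ?(x_sub_neq0 hK).
by case: UR.
Qed.

Let mul_pi P : exists l, O ((x - iota a) ^+ l * px P).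
Proof. by exists 0%N; rewrite expr0 mul1r. Qed.

(** Both sides of y^m - b^m = x^n - a^n factor, and the cofactor of y - b is a unit
    when the residue b of y is not zero. *)
Lemma parameter_unramified : U y -> good_parameter D O (x - iota a).
Proof.
move=> Uy; have [b bE] := closed_nth_root (a ^+ n + 1) m_gt0.
have [b' b'E Mb] : exists2 b', b' ^+ m = a ^+ n + 1 & M (y - iota b').
  have P0 : 'X^m - (a ^+ n + 1)%:P != 0 :> {poly F} by rewrite -size_poly_gt0 size_XnsubC.
  have [|r] := residue_root P0 Oy.
    rewrite rmorphB rmorphXn /= map_polyX map_polyC !hornerE yE.
    have -> : x ^+ n + 1 - iota (a ^+ n + 1) = x ^+ n - iota a ^+ n.
      by rewrite rmorphD rmorph1 rmorphXn; ring.
    rewrite subrXX; apply: (max_ideal_mul hO) => //.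
    apply: (place_bigsum hO) => i _; apply: (place_mul hO); apply: (placeX hO) => //.
    exact: (place_const hO).
  by rewrite rootE !hornerE subr_eq0 => /eqP rE Mr; exists r.
have b0 : b' != 0.
  apply/eqP => E; move: Mb; rewrite E rmorph0 subr0 => /max_ideal_nunit; exact.
have [q [Aq Uq qE]] := difference_quotient (adjoin_r iota x y) Oy Mb b0 mF.
pose q' := \sum_(i < n) x ^+ (n.-1 - i) * iota a ^+ i.
have xa0 : x - iota a != 0 := x_sub_neq0 hK m_gt0 a.
have Dt : D (x - iota a) = 1 by rewrite raddfB /= Dx DF subr0.
apply: (@smooth_point_parameter F K iota D DM DF O x y _ a b' 1 q 1 q' hO) => //.
- exact: (function_field_frac hK).
- by apply: adjoin_sub; [apply: adjoin_l | apply: adjoin_const].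
- exact: adjoin1.
- exact: adjoin1.
- exact: (place_unit1 hO).
- by rewrite mul1r mulr1.
- apply: adjoin_bigsum => i _; apply: adjoin_mul; apply: adjoinX; first exact: adjoin_l.
  exact: adjoin_const.
- rewrite qE yE -rmorphXn b'E rmorphD rmorph1 rmorphXn -subrXX; ring.
- apply: (@separated _ _ _ (x - iota a) 1 1) => //; [exact: (place_unit1 hO) | by rewrite mulr1].
- by rewrite Dt oner_eq0.
- by rewrite Dt Dx divr1; apply: (place1 hO).
- rewrite Dt divr1 derivation_y; apply: (place_mul hO).
    by apply: (place_mul hO); [apply: (place_nat hO) | apply: (placeX hO)].
  have [] // : U (m%:R * y ^+ m.-1).
  apply: (place_unitM hO); last exact: (place_unitX hO).
  by rewrite -(rmorph_nat iota); apply: (place_unit_const hO).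
Qed.

Lemma ramified_residue : M y -> a ^+ n = -1.
Proof.
move=> My; apply: contrapT => /eqP; rewrite -addr_eq0 => /(place_unit_const hO) Ua.
apply: (max_ideal_nunit _ Ua).
have := residue_poly ('X^n + 1) Ma Ox.
rewrite rmorphD rmorphXn rmorph1 /= map_polyX !hornerE -yE => My'.
rewrite -[iota _](subKr (y ^+ m)); apply: (max_idealB hO) => //; exact: (max_idealX hO).
Qed.

Lemma ramified_x_unit : M y -> U x.
Proof.
move=> My; apply: (place_unit_root hO n_gt0).
rewrite -[x ^+ n](addrK 1) -yE addrC; apply: (place_unitD hO); last exact: (max_idealX hO).
by apply/(place_unitN hO)/(place_unit1 hO).
Qed.

(** This is x^n - a^n = y^m, where the cofactor of x - a on the left is a unit. *)
Lemma ramified_pi : M y -> exists2 q, U q & (x - iota a) * q = y ^+ m.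
Proof.
move=> My; have an := ramified_residue My.
have a0 : a != 0.
  by apply: contra_eq_neq an => ->; rewrite expr0n gtn_eqF // eq_sym oppr_eq0 oner_eq0.
have [q [_ Uq qE]] := difference_quotient (adjoin_l iota x y) Ox Ma a0 nF.
by exists q => //; rewrite mulrC qE -rmorphXn an rmorphN rmorph1 opprK yE.
Qed.

(** By the same factorization x - a is a multiple of y^m, so that y generates the
    ideal of the point (a, 0). *)
Lemma parameter_ramified : M y -> good_parameter D O y.
Proof.
move=> My; have an := ramified_residue My.
have a0 : a != 0.
  by apply: contra_eq_neq an => ->; rewrite expr0n gtn_eqF // eq_sym oppr_eq0 oner_eq0.
have [q [Aq Uq qE]] := difference_quotient (adjoin_l iota x y) Ox Ma a0 nF.
have qy : q * (x - iota a) = y ^+ m by rewrite qE -rmorphXn an rmorphN rmorph1 opprK yE.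
have Dy0 : D y != 0.
  by rewrite derivation_y !mulf_neq0 ?invr_eq0 ?mulf_neq0 ?expf_neq0.
have Ux := ramified_x_unit My.
apply: (@smooth_point_parameter F K iota D DM DF O x y _ a 0 q 1 (y ^+ m.-1) 1 hO) => //.
- exact: (function_field_frac hK).
- exact: adjoin_r.
- by apply: adjoinX; apply: adjoin_r.
- by rewrite qy -exprS prednK.
- exact: adjoin1.
- exact: adjoin1.
- exact: (place_unit1 hO).
- by rewrite rmorph0 subr0 mulrC.
- by apply: (@separated _ _ _ (x - iota a) q m) => //; rewrite mulrC.
- rewrite Dx derivation_y invf_div mul1r; apply: (place_mul hO).
    by apply: (place_mul hO); [apply: (place_nat hO) | apply: (placeX hO)].
  have [] // : U (n%:R * x ^+ n.-1).
  apply: (place_unitM hO); last exact: (place_unitX hO).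
  by rewrite -(rmorph_nat iota); apply: (place_unit_const hO).
- by rewrite divff //; apply: (place1 hO).
Qed.
End Finite.

Section Infinite.
Hypothesis Mx : M x^-1.

(** Divided by x^deg P, P(x) is its leading coefficient plus multiples of 1/x. *)
Lemma infinite_lead P : P != 0 -> U (px P / x ^+ (size P).-1).
Proof.
move=> P0; have s0 : (0 < size P)%N by rewrite size_poly_gt0.
have le_s : (size (map_poly iota P) <= (size P).-1.+1)%N by rewrite size_map_poly prednK.
rewrite (horner_coef_wide _ le_s) big_ord_recr /= mulrDl addrC.
apply: (place_unitD hO).
  rewrite mulfK ?expf_neq0 // coef_map -/(lead_coef P); apply: (place_unit_const hO).
  by rewrite lead_coef_eq0.
rewrite mulr_suml; apply: big_ind => [||i _]; [exact: max_ideal0 hO | exact: (max_idealD hO)|].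
rewrite coef_map /=.
have -> : iota P`_i * x ^+ i / x ^+ (size P).-1 = x^-1 ^+ ((size P).-1 - i) * iota P`_i.
  have -> : x ^+ (size P).-1 = x ^+ ((size P).-1 - i) * x ^+ i.
    by rewrite -exprD subnK // ltnW.
  by rewrite exprVn; field; rewrite !expf_neq0.
apply: (max_ideal_mul hO); last exact: (place_const hO).
by apply: (max_idealX hO) => //; rewrite subn_gt0.
Qed.

Let divides_pi P : P != 0 -> exists l, O (x^-1 ^+ l / px P).
Proof.
move=> P0; exists 0%N; have [_ _] := infinite_lead P0; rewrite expr0 invf_div => Oi.
have -> : 1 / px P = x ^+ (size P).-1 / px P * x^-1 ^+ (size P).-1.
  by rewrite exprVn; field; rewrite expf_neq0 // pxP.
by apply: (place_mul hO) => //; apply: (placeX hO); case: Mx.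
Qed.

Let mul_pi P : exists l, O (x^-1 ^+ l * px P).
Proof.
have [->|/infinite_lead[_ Ol _]] := eqVneq P 0.
  by exists 0%N; rewrite rmorph0 horner0 mulr0; apply: (place0 hO).
by exists (size P).-1; rewrite exprVn mulrC.
Qed.

(** Divided by x^n, the equation of the curve reads y^m / x^n = 1 + x^-n. *)
Lemma infinite_ratio_unit : M (y ^+ m / x ^+ n - 1).
Proof.
rewrite yE mulrDl divff ?expf_neq0 // addrC addKr mul1r -exprVn.
exact: (max_idealX hO).
Qed.

Let logD j k : x * D (y ^+ j / x ^+ k) / (y ^+ j / x ^+ k) =
  j%:R * (n%:R / m%:R) * (x ^+ n / y ^+ m) - k%:R.
Proof.
have E (z w : K) l : z != 0 -> z ^+ l.-1 * w *+ l = l%:R * z ^+ l / z * w.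
  move=> z0; case: l => [|l]; first by rewrite mulr0n !mul0r.
  by rewrite -mulr_natl exprS /=; field.
have yyE : y ^+ m.-1 = y ^+ m / y by rewrite -{2}(prednK m_gt0) exprSr mulfK.
have xxE : x ^+ n.-1 = x ^+ n / x by rewrite -{2}(prednK n_gt0) exprSr mulfK.
rewrite (derivation_div DM) ?expf_neq0 // !(derivation_exp DM) Dx derivation_y !E // yyE xxE.
by field; rewrite x0 y0 mK0 !expf_neq0.
Qed.

(** Put g = gcd(m, n), m' = m / g, n' = n / g.  At infinity x and y have poles of
    order m' and n', so with u m' = v n' + 1 the monomial t = y^v / x^u has order
    one and W = y^m' / x^n' order zero.  Conversely x = W^v / t^m' and
    y = W^u / t^n', and the equation of the curve becomes
    W^g = 1 + t^(m' n) W^(- v n), which is smooth at t = 0, W^g = 1. *)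
Lemma parameter_infinite : exists t, [/\ good_parameter D O t & U (x * D t / t)].
Proof.
pose g := gcdn m n; pose m' := (m %/ g)%N; pose n' := (n %/ g)%N.
have g_gt0 : (0 < g)%N by rewrite gcdn_gt0 m_gt0.
have mE : m = (m' * g)%N by rewrite divnK // dvdn_gcdl.
have nE : n = (n' * g)%N by rewrite divnK // dvdn_gcdr.
have m'_gt0 : (0 < m')%N by move: m_gt0; rewrite mE muln_gt0 => /andP[].
have n'_gt0 : (0 < n')%N by move: n_gt0; rewrite nE muln_gt0 => /andP[].
have cop : coprime m' n'.
  by rewrite /coprime -(eqn_pmul2r g_gt0) muln_gcdl -mE -nE mul1n.
have [u [v uv]] : exists u v, (u * m' = (v * n').+1)%N.
  by have [u v uv _] := egcdnP n' m'_gt0; exists u, v; rewrite uv (eqP cop) addn1.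
have mK' : m'%:R != 0 :> K by move: mK0; rewrite mE natrM mulf_eq0 negb_or => /andP[].
have gF : g%:R != 0 :> F by move: mF; rewrite mE natrM mulf_eq0 negb_or => /andP[].
have gK : g%:R != 0 :> K by rewrite -(rmorph_nat iota) fmorph_eq0.
pose t := y ^+ v / x ^+ u; pose W := y ^+ m' / x ^+ n'.
have t0 : t != 0 by rewrite mulf_neq0 ?invr_eq0 ?expf_neq0.
have W0 : W != 0 by rewrite mulf_neq0 ?invr_eq0 ?expf_neq0.
have Wg : W ^+ g = y ^+ m / x ^+ n by rewrite expr_div_n -!exprM -mE -nE.
have xE : t ^+ m' * x = W ^+ v.
  rewrite !expr_div_n -!exprM [(u * m')%N]uv mulnC [(v * n')%N]mulnC exprS; field.
  by rewrite x0 expf_neq0.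
have yE' : t ^+ n' * y = W ^+ u.
  rewrite !expr_div_n -!exprM [(m' * u)%N]mulnC uv [(u * n')%N]mulnC exprS; field.
  by rewrite expf_neq0.
have UWg : U (W ^+ g).
  rewrite Wg -[_ / _](subrK 1) addrC.
  by apply: (place_unitD hO); [exact: (place_unit1 hO) | exact: infinite_ratio_unit].
have UW := place_unit_root hO g_gt0 UWg.
have OW := place_unit_sub UW.
have UWv := place_unitX hO v UW.
have pit : x^-1 * W ^+ v = t ^+ m' by rewrite -xE; field.
have Mt : M t.
  by apply: (max_ideal_root hO m'_gt0); rewrite -pit; apply: (max_ideal_mul hO) => //; case: UWv.
have [zt [zt1 Mzt]] : exists zt, zt ^+ g = 1 /\ M (W - iota zt).
  have P0 : 'X^g - 1 != 0 :> {poly F} by rewrite -size_poly_gt0 size_XnsubC.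
  have [|r] := residue_root P0 OW.
    by rewrite rmorphB rmorphXn rmorph1 /= map_polyX !hornerE Wg; apply: infinite_ratio_unit.
  by rewrite rootE !hornerE subr_eq0 => /eqP rE Mr; exists r.
have zt0 : zt != 0.
  by apply: contra_eq_neq zt1 => ->; rewrite expr0n gtn_eqF // eq_sym oner_eq0.
have [q [Aq Uq qE]] := difference_quotient (adjoin_r iota t W) OW Mzt zt0 gF.
have Wx : W ^+ g - 1 = x^-1 ^+ n.
  by rewrite Wg yE exprVn; field; rewrite expf_neq0.
have sgmon j k : forall i, exists c, sg i (y ^+ j / x ^+ k) = iota c * (y ^+ j / x ^+ k).
  move=> i; exists (zeta ^+ (i * j)); rewrite fmorph_div !rmorphXn sgx sgy exprMn /=.
  by rewrite exprM -!rmorphXn mulrA.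
(* The constant term is v n' / m' - u = - 1 / m'. *)
have DtE := logD v u; rewrite -/t in DtE.
have UR : U (x ^+ n / y ^+ m).
  by rewrite -invf_div -Wg; apply: place_unitV.
have UDt : U (x * D t / t).
  have -> : x * D t / t = iota (- m'%:R^-1) -
      v%:R * (n%:R / m%:R) * (x ^+ n / y ^+ m) * (y ^+ m / x ^+ n - 1).
    rewrite DtE rmorphN fmorphV rmorph_nat mE nE !natrM.
    have -> : u%:R = (v%:R * n'%:R + 1) / m'%:R :> K.
      by rewrite -natrM -[1]/(1%:R) -natrD addn1 -uv natrM mulfK.
    by field; rewrite gK mK' !expf_neq0.
  apply: (place_unitD hO).
    by apply: (place_unit_const hO); rewrite oppr_eq0 invr_eq0 -(fmorph_eq0 iota) rmorph_nat.
  apply: (max_idealN hO); rewrite mulrC; apply: (max_ideal_mul hO); first exact: infinite_ratio_unit.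
  apply: (place_mul hO); last by case: UR.
  by rewrite -!(rmorph_nat iota) -fmorph_div -rmorphM; apply: (place_const hO).
have Dt0 : D t != 0.
  by have := place_unit_neq0 UDt; rewrite !mulf_eq0 !negb_or => /andP[/andP[]].
exists t; split=> //.
pose qq := q * W ^+ (v * n).
have Uqq : U qq by apply: (place_unitM hO) => //; apply: (place_unitX hO).
apply: (@smooth_point_parameter F K iota D DM DF O t W t 0 zt 1 qq 1 (t ^+ (m' * n).-1) hO) => //.
- by case: Mt.
- elim/(function_field_ind hK) => [c||| z1 z2 [a1 [b1 [Aa1 Ab1 b10 ->]]] [a2 [b2 [Aa2 Ab2 b20 ->]]]
    | z1 z2 [a1 [b1 [Aa1 Ab1 b10 ->]]] [a2 [b2 [Aa2 Ab2 b20 ->]]] | z z0 [a [b [Aa Ab b0 zE]]]].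
  + by exists (iota c), 1; rewrite divr1 oner_eq0; split=> //; [exact: adjoin_const | exact: adjoin1].
  + exists (W ^+ v), (t ^+ m'); rewrite -xE expf_neq0 //; split=> //.
    - by rewrite xE; apply: adjoinX; apply: adjoin_r.
    - by apply: adjoinX; apply: adjoin_l.
    - by rewrite mulrAC divff ?mul1r // expf_neq0.
  + exists (W ^+ u), (t ^+ n'); rewrite -yE' expf_neq0 //; split=> //.
    - by rewrite yE'; apply: adjoinX; apply: adjoin_r.
    - by apply: adjoinX; apply: adjoin_l.
    - by rewrite mulrAC divff ?mul1r // expf_neq0.
  + exists (a1 * b2 - a2 * b1), (b1 * b2); split.
    - by apply: adjoin_sub; apply: adjoin_mul.
    - exact: adjoin_mul.
    - exact: mulf_neq0.
    - by field; rewrite b10 b20.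
  + exists (a1 * a2), (b1 * b2); split.
    - exact: adjoin_mul.
    - exact: adjoin_mul.
    - exact: mulf_neq0.
    - by field; rewrite b10 b20.
  + exists b, a; split=> //; last by rewrite zE invf_div.
    by apply: contraNneq z0 => a0; rewrite zE a0 mul0r.
- exact: adjoin_l.
- exact: adjoin1.
- exact: adjoin1.
- exact: (place_unit1 hO).
- by rewrite rmorph0 subr0 mulrC.
- by apply: adjoin_mul => //; apply: adjoinX; apply: adjoin_r.
- by apply: adjoinX; apply: adjoin_l.
- rewrite mulrAC qE -rmorphXn zt1 rmorph1 Wx exprM -exprMn pit -exprM -exprS.
  by rewrite prednK // muln_gt0 m'_gt0.
- by apply: (separated (sgmon v u) (sgmon m' n') divides_pi mul_pi _ OW Mt t0 UWv pit); case: Mt.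
- by rewrite divff //; apply: (place1 hO).
- have -> : D W / D t = (x * D t / t)^-1 * W * (- n'%:R) * (x ^+ n / y ^+ m) * (x^-1 ^+ n / t).
    have -> : D W / D t = (x * D W / W) / (x * D t / t) * (W / t).
      by field; rewrite x0 t0 W0 Dt0.
    rewrite [x * D W / W]logD.
    have -> : m'%:R * (n%:R / m%:R) = n'%:R :> K by rewrite mE nE !natrM; field; rewrite gK mK'.
    have -> : n'%:R * (x ^+ n / y ^+ m) - n'%:R = - n'%:R * (x ^+ n / y ^+ m) * x^-1 ^+ n.
      by rewrite -Wx Wg; field; rewrite !expf_neq0.
    by field; rewrite x0 t0 Dt0 !expf_neq0.
  have tE : x^-1 ^+ n / t = t ^+ (m' * n).-1 * W^-1 ^+ (v * n).
    have -> : x^-1 = t ^+ m' * W^-1 ^+ v by rewrite -pit exprVn mulfK // expf_neq0.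
    rewrite exprMn -!exprM -{1}(prednK (_ : 0 < m' * n)%N) ?muln_gt0 ?m'_gt0 // exprS.
    by field; rewrite ?t0 ?W0 ?expf_neq0.
  have OWi : O W^-1 by case: UW.
  rewrite tE; apply: (place_mul hO); last by apply: (place_mul hO); apply: (placeX hO) => //; case: Mt.
  apply: (place_mul hO); last by case: UR.
  apply: (place_mul hO); last by apply/(placeN hO)/(place_nat hO).
  by apply: (place_mul hO) => //; case: UDt.
Qed.
End Infinite.
End AtPlace.

(** * Regular differentials *)

(** What holomorphy of [G dx] at [O] says about [G]. *)
Definition regular (O : K -> Prop) (G : K) :=
  exists t g, [/\ local_parameter O t, O g & G = g * D t].

Lemma local_parameter_max_ideal O t : place iota O -> local_parameter O t -> max_ideal O t.
Proof. by move=> hO tP; apply/tP; exists 1; [apply: (place1 hO) | rewrite mul1r]. Qed.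

(** An automorphism permutes the places and commutes with D. *)
Lemma sg_regular G : (forall O, place iota O -> regular O G) ->
  forall k O t, place iota O -> good_parameter D O t -> O (sg k G / D t).
Proof.
move=> rG k O t hO [_ _ tD]; pose O' z := O (sg k z).
have hO' : place iota O'.
  split=> [a|u v|u v||z z0].
  - by rewrite /O' sgF; apply: (place_const hO).
  - by rewrite /O' rmorphB; apply: (place_sub hO).
  - by rewrite /O' rmorphM; apply: (place_mul hO).
  - have [z nz] := place_proper hO; have [w wz] := sg_surj k z.
    by exists w; rewrite /O' wz.
  - by rewrite /O' fmorphV; apply: (place_valuation hO); rewrite fmorph_eq0.
have [t' [g [t'P Og ->]]] := rG O' hO'.
rewrite rmorphM -sg_D -mulrA; apply: (place_mul hO) => //; apply: tD.
by case: (local_parameter_max_ideal hO' t'P).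
Qed.

(** The projection of [G] onto the functions on which the group acts as on y^-b. *)
Definition component b G := m%:R^-1 * \sum_(k < m) iota (zeta ^+ (k * b)) * sg k G.

Lemma sum_component G : \sum_(b < m) component b G = G.
Proof.
rewrite -mulr_sumr exchange_big /=.
have E k : \sum_(b < m) iota (zeta ^+ (k * b)) * sg k G =
    iota (if (m %| k)%N then m%:R else 0) * sg k G.
  rewrite -mulr_suml -rmorph_sum -(prim_root_sum k zetaP).
  by congr (iota _ * _); apply: eq_bigr => b _; rewrite mulnC.
under eq_bigr => k _ do rewrite E.
rewrite (bigD1 (Ordinal m_gt0)) //= dvdn0 big1 => [|k k0].
  by rewrite addr0 rmorph_nat sg0 mulKf.
rewrite ifN ?rmorph0 ?mul0r // gtnNdvd // lt0n; apply: contra k0 => /eqP k0.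
exact/eqP/val_inj.
Qed.

Lemma component_fixed b G k : sg k (component b G * y ^+ b) = component b G * y ^+ b.
Proof.
apply: sg_fixed; rewrite rmorphM rmorphXn sgy expr1 exprMn mulrA; congr (_ * _).
rewrite rmorphM fmorphV rmorph_nat rmorph_sum -mulrA; congr (_ * _).
rewrite mulr_suml -(prednK m_gt0) big_ord_recr big_ord_recl /= addrC.
rewrite mul0n expr0 sg0 rmorphM sgF -sg_comp add1n prednK // sg_period; congr (_ + _).
  rewrite rmorph1 mul1r mulrAC -rmorphXn -rmorphM -exprD -mulSnr.
  by rewrite prednK // exprM (prim_expr_order zetaP) expr1n rmorph1 mul1r.
apply: eq_bigr => i _; rewrite rmorphM sgF -sg_comp mulrAC -rmorphXn -rmorphM -exprD -mulSnr.
by rewrite /bump !add1n.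
Qed.

Lemma component_regular G : (forall O, place iota O -> regular O G) ->
  forall b O t, place iota O -> good_parameter D O t -> O (component b G / D t).
Proof.
move=> rG b O t hO tg; rewrite /component -mulrA mulr_suml; apply: (place_mul hO).
  by rewrite -(rmorph_nat iota) -fmorphV; apply: (place_const hO).
apply: (place_bigsum hO) => k _; rewrite -mulrA; apply: (place_mul hO).
  exact: (place_const hO).
exact: sg_regular.
Qed.

(** No polynomial in x is inverse to x - a, since x is transcendental. *)
Let finite_place_ex a : exists O, [/\ place iota O, max_ideal O (x - iota a) & O x].
Proof.
have [||||||O [hO Mx RO]] := @place_exists F K iota (fun z => exists P, z = px P) (x - iota a).
- by move=> c; exists c%:P; rewrite map_polyC hornerC.
- by move=> _ _ [P ->] [Q ->]; exists (P - Q); rewrite rmorphB hornerD hornerN.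
- by move=> _ _ [P ->] [Q ->]; exists (P * Q); rewrite rmorphM hornerM.
- exact: (x_sub_neq0 hK).
- by exists ('X - a%:P); rewrite rmorphB /= map_polyX map_polyC hornerXsubC.
- move=> [P PE]; have nz : P * ('X - a%:P) - 1 != 0.
    apply/eqP => /(congr1 (fun R => R.[a])); rewrite !hornerE subrr mulr0 sub0r => /eqP.
    by rewrite oppr_eq0 oner_eq0.
  have := pxP nz; rewrite rmorphB rmorphM rmorphB rmorph1 /= map_polyX map_polyC !hornerE -PE.
  by rewrite mulVf ?subrr ?eqxx // (x_sub_neq0 hK).
by exists O; split=> //; apply: RO; exists 'X; rewrite map_polyX hornerX.
Qed.

(** No polynomial in 1/x is equal to x, since x is transcendental. *)
Let infinite_place_ex : exists O, place iota O /\ max_ideal O x^-1.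
Proof.
have [||||||O [hO Mx RO]] :=
  @place_exists F K iota (fun z => exists P, z = (map_poly iota P).[x^-1]) x^-1.
- by move=> c; exists c%:P; rewrite map_polyC hornerC.
- by move=> _ _ [P ->] [Q ->]; exists (P - Q); rewrite rmorphB hornerD hornerN.
- by move=> _ _ [P ->] [Q ->]; exists (P * Q); rewrite rmorphM hornerM.
- by rewrite invr_eq0.
- by exists 'X; rewrite map_polyX hornerX.
- rewrite invrK => -[P PE].
  pose d := size P; pose Q := 'X^(d.+1) - \sum_(i < d) P`_i *: 'X^(d - i).
  have nz : Q != 0.
    apply/eqP => /(congr1 (fun R : {poly F} => R`_d.+1)); rewrite coef0 coefB coefXn eqxx coef_sum.
    rewrite big1 => [/eqP|i _]; first by rewrite subr0 oner_eq0.
    by rewrite coefZ coefXn gtn_eqF ?mulr0 // ltnS leq_subr.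
  have := pxP nz; rewrite rmorphB rmorph_sum /= map_polyXn hornerD hornerN hornerXn horner_sum.
  rewrite exprS {1}PE horner_coef size_map_poly mulr_suml -sumrB big1 ?eqxx // => i _.
  rewrite coef_map map_polyZ /= map_polyXn hornerZ hornerXn.
  have -> : x ^+ size P = x ^+ (size P - i) * x ^+ i by rewrite -exprD subnK // ltnW.
  by rewrite exprVn; field; rewrite expf_neq0.
by exists O.
Qed.

(** Let a be a root of the denominator of f.  At a place over a, either y is a unit
    and f is regular in the parameter x - a, or y is a parameter with
    D y = n x^(n-1) / (m y^(m-1)), and f y^(m-1-b) is regular; as x - a is y^m up
    to a unit and b < m, f would be regular at a in both cases.  So f is a
    polynomial.  At infinity f y^-b dx is x^d y^-b dt / t up to a unit, where
    d is the size of f, so x^d y^-b has to vanish there. *)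
Lemma regular_component b f : (b < m)%N -> (forall k, sg k f = f) ->
    (forall O t, place iota O -> good_parameter D O t -> O (f / y ^+ b / D t)) ->
  exists2 P, f = px P & P != 0 -> (size P * m < n * b)%N.
Proof.
move=> lt_bm ff rf; have [P [Q [Q0 cPQ fE]]] := fixed_ratio ff.
have yb0 : y ^+ b != 0 by rewrite expf_neq0.
have sQ : size Q = 1%N.
  apply/eqP; apply: contraT => /closed_rootP[a Qa].
  have Pa : P.[a] != 0.
    apply: contraL Qa => Pa; apply: contraL cPQ => Qa; apply/negP => cPQ.
    by have := coprimep_root cPQ Pa; rewrite -rootE Qa.
  have [R QE] := factor_theorem _ _ Qa.
  have {QE} QE : px Q = px R * (x - iota a).
    by rewrite QE rmorphM rmorphB /= map_polyX map_polyC hornerM hornerXsubC.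
  have [O [hO Mx Ox]] := finite_place_ex a.
  have Opx S : O (px S).
    rewrite horner_coef; apply: (place_bigsum hO) => i _.
    by apply: (place_mul hO); [rewrite coef_map; apply: (place_const hO) | apply: (placeX hO)].
  have UP : place_unit O (px P).
    rewrite -[px P](subrK (iota P.[a])) addrC; apply: (place_unitD hO).
      exact: (place_unit_const hO).
    exact: (residue_poly hO).
  have PE : px P = f * (px R * (x - iota a)) by rewrite -QE fE divfK // pxP.
  have Oy : O y.
    apply: (place_root hO m_gt0); rewrite yE.
    by apply: (placeD hO); [apply: (placeX hO) | apply: (place1 hO)].
  case: (@max_ideal_nunit _ O (px P)) => //.
  have [My|Uy] := place_cases hO Oy.
    have [q Uq qE] := ramified_pi hO Ox Mx My.
    have := rf O y hO (parameter_ramified hO Ox Mx My).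
    have q0 := place_unit_neq0 Uq.
    have -> : px P = y * (f / y ^+ b / D y * (n%:R / m%:R * x ^+ n.-1 * y ^+ b / q * px R)).
      have -> : px P = f * (px R * (y ^+ m / q)) by rewrite PE -qE mulfK.
      have -> : y ^+ m = y ^+ m.-1 * y by rewrite -exprSr prednK.
      rewrite derivation_y; field.
      by rewrite ?x0 ?y0 ?mK0 ?nK0 ?q0 !expf_neq0.
    move=> Of; apply: (max_ideal_mul hO) => //; apply: (place_mul hO) => //.
    apply: (place_mul hO) => //; apply: (place_mul hO); last by case: Uq.
    apply: (place_mul hO); last exact: (placeX hO).
    apply: (place_mul hO); last exact: (placeX hO).
    by rewrite -!(rmorph_nat iota) -fmorph_div; apply: (place_const hO).
  have := rf O _ hO (parameter_unramified hO Ox Mx Uy).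
  rewrite raddfB /= Dx DF subr0 divr1 => Of.
  have -> : px P = (x - iota a) * (f / y ^+ b * y ^+ b * px R).
    by rewrite PE; field.
  apply: (max_ideal_mul hO) => //; apply: (place_mul hO) => //.
  by apply: (place_mul hO) => //; apply: (placeX hO).
have [c c0 Qc] : exists2 c, c != 0 & Q = c%:P by apply/size_poly1P/eqP.
have {P Q Q0 cPQ sQ Qc fE} [P fE] : exists P, f = px P.
  by exists (c^-1 *: P); rewrite fE Qc map_polyC hornerC map_polyZ hornerZ /= fmorphV mulrC.
exists P => // P0; have sP : (0 < size P)%N by rewrite size_poly_gt0.
have [O [hO Mx]] := infinite_place_ex.
have [t [tg Ut]] := parameter_infinite hO Mx.
have Mt : max_ideal O t by case: tg => /(local_parameter_max_ideal hO).
have t0 : t != 0 by case: tg => _ + _; apply: contraNneq => ->; rewrite raddf0.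
have Dt0 : D t != 0 by case: tg.
have UP := infinite_lead hO Mx P0; have fP0 := pxP P0.
have : max_ideal O (x ^+ size P / y ^+ b).
  have -> : x ^+ size P / y ^+ b =
      t * (f / y ^+ b / D t * (px P / x ^+ (size P).-1)^-1 * (x * D t / t)).
    rewrite fE -{1}(prednK sP) exprSr; field.
    by rewrite ?t0 ?Dt0 ?fP0 !expf_neq0.
  apply: (max_ideal_mul hO) => //; apply: (place_mul hO); last by case: Ut.
  by apply: (place_mul hO); [apply: rf | case: UP].
move=> /(max_idealX hO m_gt0); rewrite expr_div_n -!exprM.
have Or : O ((y ^+ m / x ^+ n) ^+ b).
  apply: (placeX hO); rewrite -[_ / _](subrK 1); apply: (placeD hO); last exact: (place1 hO).
  by case: (infinite_ratio_unit hO Mx).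
move=> /(max_ideal_mul hO)/(_ Or).
have -> : x ^+ (size P * m) / y ^+ (b * m) * (y ^+ m / x ^+ n) ^+ b = x ^+ (size P * m) / x ^+ (n * b).
  by rewrite expr_div_n -!exprM [(m * b)%N]mulnC; field; rewrite !expf_neq0.
rewrite ltnNge => Mz; apply/negP => le; move: Mz.
rewrite -(subnK le) exprD mulfK ?expf_neq0 //; set e := (_ - _)%N.
have Oe : O (x^-1 ^+ e) by apply: (placeX hO); case: Mx.
move=> /(max_ideal_mul hO)/(_ Oe); rewrite exprVn divff ?expf_neq0 // => /max_ideal_nunit; apply.
exact: (place_unit1 hO).
Qed.

Lemma monomial_regular O : place iota O -> exists t, good_parameter D O t /\
  forall i b, (b < m)%N -> (i.+1 * m < n * b)%N -> O (x ^+ i / y ^+ b / D t).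
Proof.
move=> hO; have [Ox|/(place_pole hO) Mx] := EM (O x); last first.
  have [t [tg Ut]] := parameter_infinite hO Mx; exists t; split=> // i b _ lt_ib.
  have [tP Dt0 _] := tg.
  have t0 : t != 0 by apply: contraNneq Dt0 => ->; rewrite raddf0.
  have [u Ou uE] : exists2 u, O u & x ^+ i.+1 / y ^+ b = u * t.
    apply/tP; apply: (max_ideal_root hO m_gt0); rewrite expr_div_n -!exprM.
    have U1 : place_unit O ((y ^+ m / x ^+ n) ^+ b).
      apply: (place_unitX hO); rewrite -[_ / _](subrK 1) addrC.
      apply: (place_unitD hO); first exact: (place_unit1 hO).
      exact: (infinite_ratio_unit hO Mx).
    apply: (max_ideal_unit hO U1).
    have -> : (y ^+ m / x ^+ n) ^+ b * (x ^+ (i.+1 * m) / y ^+ (b * m)) = x^-1 ^+ (n * b - i.+1 * m).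
      rewrite expr_div_n -!exprM [(b * m)%N]mulnC -{1}(subnK (ltnW lt_ib)) exprD exprVn.
      by field; rewrite !expf_neq0.
    by apply: (max_idealX hO) => //; rewrite subn_gt0.
  have -> : x ^+ i / y ^+ b / D t = u * (x * D t / t)^-1.
    have -> : u = x ^+ i.+1 / y ^+ b / t by rewrite uE mulfK.
    by rewrite exprS; field; rewrite ?x0 ?t0 ?Dt0 ?expf_neq0.
  by apply: (place_mul hO) => //; case: Ut.
have Oy : O y.
  apply: (place_root hO m_gt0); rewrite yE.
  by apply: (placeD hO); [apply: (placeX hO) | apply: (place1 hO)].
have [a Ma] := finite_residue hO Ox.
have [My|Uy] := place_cases hO Oy.
  exists y; split=> [|i b lt_bm _]; first exact: (parameter_ramified hO Ox Ma My).
  have Ux := ramified_x_unit hO My.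
  have -> : x ^+ i / y ^+ b / D y = m%:R / n%:R * x ^+ i * (x ^+ n.-1)^-1 * y ^+ (m.-1 - b).
    have -> : y ^+ (m.-1 - b) = y ^+ m.-1 / y ^+ b.
      have le_b : (b <= m.-1)%N by rewrite -ltnS prednK.
      by rewrite -{2}(subnK le_b) exprD mulfK ?expf_neq0.
    by rewrite derivation_y; field; rewrite ?mK0 ?nK0 ?expf_neq0.
  apply: (place_mul hO); last exact: (placeX hO).
  apply: (place_mul hO); last by case: (place_unitX hO n.-1 Ux).
  apply: (place_mul hO); last exact: (placeX hO).
  by rewrite -!(rmorph_nat iota) -fmorph_div; apply: (place_const hO).
exists (x - iota a); split=> [|i b _ _]; first exact: (parameter_unramified hO Ox Ma Uy).
rewrite raddfB /= Dx DF subr0 divr1; apply: (place_mul hO); first exact: (placeX hO).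
by case: (place_unitX hO b Uy).
Qed.

(** The pair (i, b) stands for x^i y^-b dx, so the exponent of x is shifted by one. *)
Definition admissible (ib : 'I_n * 'I_m) : bool := (ib.1.+1 * m < n * ib.2)%N.

Definition monomial (ib : 'I_n * 'I_m) := x ^+ val ib.1 / y ^+ val ib.2.

Lemma regular_span G : (forall O, place iota O -> regular O G) ->
  exists c : 'I_n * 'I_m -> F, G = \sum_(ib | admissible ib) iota (c ib) * monomial ib.
Proof.
move=> rG; have cP (b : 'I_m) : exists P : {poly F},
    component b G * y ^+ b = px P /\ (P != 0 -> (size P * m < n * b)%N).
  have [|O t hO tg|P E le] := regular_component (ltn_ord b) (f := component b G * y ^+ b).
  - exact: component_fixed.
  - by rewrite mulfK ?expf_neq0 //; apply: component_regular.
  - by exists P.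
have [P PE] := choice cP.
exists (fun ib : 'I_n * 'I_m => (P ib.2)`_ib.1); rewrite -{1}(sum_component G).
transitivity (\sum_(b < m) \sum_(i < n) if admissible (i, b) then
    iota (P b)`_i * monomial (i, b) else 0); last first.
  by rewrite exchange_big pair_bigA [RHS]big_mkcond; apply: eq_bigr => -[].
apply: eq_bigr => b _; have [E le] := PE b.
have sPn : (size (map_poly iota (P b)) <= n)%N.
  rewrite size_map_poly; have [->|/le lt] := eqVneq (P b) 0; first by rewrite size_poly0.
  rewrite -(leq_pmul2r m_gt0); apply: ltnW; apply: (leq_trans lt).
  by rewrite leq_pmul2l // ltnW.
have -> : component b G = px (P b) / y ^+ b by rewrite -E mulfK // expf_neq0.
rewrite (horner_coef_wide _ sPn) mulr_suml; apply: eq_bigr => i _.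
rewrite coef_map /monomial /= mulrA; case: ifPn => //; rewrite /admissible /= -leqNgt => le_i.
have [lt_is|le_si] := ltnP i (size (P b)); last by rewrite nth_default // rmorph0 !mul0r.
have Pb0 : P b != 0 by rewrite -size_poly_gt0 (leq_trans _ lt_is).
have := le Pb0; rewrite ltnNge (leq_trans le_i) // leq_mul2r lt_is orbT //.
Qed.
Lemma component_monomial b i (a : 'I_m) : (b < m)%N ->
  component b (x ^+ i / y ^+ a) = if b == a then x ^+ i / y ^+ a else 0.
Proof.
move=> lt_bm; have am := ltn_ord a.
have -> : component b (x ^+ i / y ^+ a) =
    m%:R^-1 * iota (\sum_(k < m) zeta ^+ (k * (b + (m - a)))) * (x ^+ i / y ^+ a).
  rewrite /component -mulrA; congr (_ * _); rewrite rmorph_sum mulr_suml; apply: eq_bigr => k _.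
  have Z0 : iota (zeta ^+ k) != 0.
    by rewrite fmorph_eq0 expf_neq0 // (prim_root_eq0 zetaP) -lt0n.
  have ZE : iota (zeta ^+ k) ^+ (m - a) = (iota (zeta ^+ k) ^+ a)^-1.
    apply: (mulIf (expf_neq0 a Z0)); rewrite mulVf ?expf_neq0 // -exprD subnK 1?ltnW //.
    by rewrite -rmorphXn -exprM mulnC exprM (prim_expr_order zetaP) expr1n rmorph1.
  have EZ j : iota (zeta ^+ (k * j)) = iota (zeta ^+ k) ^+ j by rewrite exprM rmorphXn.
  rewrite !EZ exprD ZE fmorph_div (rmorphXn (sg k) i) (rmorphXn (sg k) a) sgx sgy exprMn.
  by field; rewrite !expf_neq0.
rewrite prim_root_sum //; have -> : (m %| b + (m - a))%N = (b == a).
  have [->|ba] := eqVneq b a; first by rewrite subnKC ?dvdnn // ltnW.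
  apply/negP => /dvdnP[[|[|k]]].
  - by rewrite mul0n => /eqP; rewrite addn_eq0 subn_eq0 leqNgt am andbF.
  - rewrite mul1n => /eqP; rewrite -[X in _ == X](subnK (ltnW am)) addnC eqn_add2l.
    by move/eqP => E; rewrite E eqxx in ba.
  - move=> E; have : (b + (m - a) < m + m)%N by rewrite -addSn leq_add // leq_subr.
    by rewrite E addnn -mul2n ltn_pmul2r.
case: eqP => _; last by rewrite rmorph0 mulr0 mul0r.
by rewrite rmorph_nat mulVf // mul1r.
Qed.

(** The components of a sum of monomials are polynomials in x up to y^-b, and x is
    transcendental. *)
Lemma monomial_free (c : 'I_n * 'I_m -> F) :
  \sum_ib iota (c ib) * monomial ib = 0 -> forall ib, c ib = 0.
Proof.
move=> c0 [i b]; have : component b (\sum_ib iota (c ib) * monomial ib) = 0.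
  by rewrite c0 /component big1 ?mulr0 // => k _; rewrite rmorph0 mulr0.
have compD u v : component b (u + v) = component b u + component b v.
  rewrite /component -mulrDr -big_split; congr (_ * _); apply: eq_bigr => k _.
  by rewrite rmorphD mulrDr.
have comp0 : component b 0 = 0.
  by rewrite /component big1 ?mulr0 // => k _; rewrite rmorph0 mulr0.
have compZ a u : component b (iota a * u) = iota a * component b u.
  rewrite /component mulrCA; congr (_ * _); rewrite mulr_sumr; apply: eq_bigr => k _.
  by rewrite rmorphM sgF mulrCA.
rewrite (big_morph _ compD comp0).
have -> : \sum_ib component b (iota (c ib) * monomial ib) =
    \sum_(i' < n) \sum_(b' < m) iota (c (i', b')) *
      (if b == b' :> nat then x ^+ i' / y ^+ b' else 0).
  rewrite pair_bigA; apply: eq_bigr => -[i' b'] _.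
  by rewrite compZ component_monomial.
under eq_bigr => i' _.
  rewrite (bigD1 b) //= eqxx big1 ?addr0 => [|b' b'b]; last first.
    by rewrite eq_sym ifN ?mulr0.
  over.
pose P := \sum_(i' < n) c (i', b) *: 'X^i'.
have -> : \sum_(i' < n) iota (c (i', b)) * (x ^+ i' / y ^+ b) = px P / y ^+ b.
  rewrite rmorph_sum horner_sum mulr_suml; apply: eq_bigr => k _.
  by rewrite /= map_polyZ map_polyXn hornerZ hornerXn mulrA.
move=> /eqP; rewrite mulf_eq0 invr_eq0 (negPf (expf_neq0 b y0)) orbF => PE.
have P0 : P = 0 by apply/eqP; apply: contraTT PE => /pxP.
have := congr1 (fun R : {poly F} => R`_i) P0; rewrite coef0 coef_sum (bigD1 i) //=.
rewrite coefZ coefXn eqxx mulr1 big1 ?addr0 // => k ki.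
by rewrite coefZ coefXn eq_sym (inj_eq val_inj) (negPf ki) mulr0.
Qed.
End Places.

(** * The Cartier operator on monomials *)

Lemma bezout_nat a p : (0 < a)%N -> coprime a p -> exists u v, (u * a = (v * p).+1)%N.
Proof.
move=> a_gt0 /eqP ap; have [u v uv _] := egcdnP p a_gt0.
by exists u, v; rewrite uv ap addn1.
Qed.

Section Logarithms.
Variables (p m n : nat) (F : closedFieldType) (K : fieldType).
Variables (iota : {rmorphism F -> K}) (x y : K).
Hypothesis hK : function_field_of iota (Fmn_poly F m n) x y.
Hypotheses (m_gt0 : (0 < m)%N) (n_gt0 : (0 < n)%N).
Hypotheses (chF : p \in [pchar F]) (mp : coprime m p).
Variable D : {additive K -> K}.
Hypothesis DM : forall u v, D (u * v) = D u * v + u * D v.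
Hypothesis Dx : D x = 1.

Lemma function_field_pchar : p \in [pchar K].
Proof. by rewrite (fmorph_pchar iota). Qed.

Let chp := function_field_pchar.
Let p_pr := pcharf_prime chF.
Let yE := curve_eq hK.
Let x0 : x != 0 := x_neq0 hK m_gt0.
Let y0 : y != 0 := y_neq0 hK m_gt0 n_gt0.

(** The field generated by x over the p-th powers contains F, which is perfect, and
    y, because it contains y^m and y^p and m is coprime to p. *)
Lemma frobenius_generated (G : K) : exists Q : {poly K}, G = \sum_(i < size Q) Q`_i ^+ p * x ^+ i.
Proof.
pose fr := pFrobenius_aut chp.
suff [Q ->] : exists Q, G = (map_poly fr Q).[x].
  exists Q; rewrite horner_coef size_map_poly; apply: eq_bigr => i _.
  by rewrite coef_map /= pFrobenius_autE.
elim/(function_field_ind hK): G => [a|||u v [Q ->] [R ->]|u v [Q ->] [R ->]|u u0 [Q QE]].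
- have [b <-] := closed_nth_root a (prime_gt0 p_pr).
  by exists (iota b)%:P; rewrite map_polyC hornerC /= pFrobenius_autE rmorphXn.
- by exists 'X; rewrite map_polyX hornerX.
- have [u [v uv]] := bezout_nat m_gt0 mp.
  exists ((y^-1 ^+ v)%:P * ('X^n + 1) ^+ u).
  have -> : map_poly fr ((y^-1 ^+ v)%:P * ('X^n + 1) ^+ u) = ((y^-1 ^+ v) ^+ p)%:P * ('X^n + 1) ^+ u.
    rewrite rmorphM /= map_polyC /= pFrobenius_autE; congr (_ * _).
    by rewrite rmorphXn rmorphD rmorph1 /= map_polyXn.
  rewrite !hornerE -yE -!exprM [(m * u)%N]mulnC uv exprS exprVn.
  by field; rewrite expf_neq0.
- by exists (Q - R); rewrite rmorphB hornerD hornerN.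
- by exists (Q * R); rewrite rmorphM hornerM.
- exists ((u^-1)%:P * Q ^+ p.-1).
  rewrite rmorphM rmorphXn /= map_polyC hornerM horner_exp hornerC -QE /= pFrobenius_autE exprVn.
  have -> : u ^+ p = u * u ^+ p.-1 by rewrite -exprS prednK // prime_gt0.
  by field; rewrite u0 expf_neq0.
Qed.

Local Notation C := (cartier DM chp Dx frobenius_generated).
Local Notation mono := (@monomial m n K x y).
Local Notation adm := (@admissible m n).

Let CF k a G : iter k C (iota (a ^+ (p ^ k)) * G) = iota a * iter k C G.
Proof. by rewrite rmorphXn cartier_iterZ. Qed.

Let Cnat k (j : nat) G : iter k C (j%:R * G) = j%:R * iter k C G.
Proof. by rewrite mulr_natl cartier_iterMn mulr_natl. Qed.

Definition in_span (G : K) := exists c : 'I_n * 'I_m -> F, G = \sum_(ib | adm ib) iota (c ib) * mono ib.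

Lemma in_span0 : in_span 0.
Proof. by exists (fun=> 0); rewrite big1 // => ib _; rewrite rmorph0 mul0r. Qed.

Lemma in_spanD u v : in_span u -> in_span v -> in_span (u + v).
Proof.
move=> [c ->] [d ->]; exists (fun ib => c ib + d ib); rewrite -big_split.
by apply: eq_bigr => ib _; rewrite rmorphD mulrDl.
Qed.

Lemma in_spanZ a u : in_span u -> in_span (iota a * u).
Proof.
move=> [c ->]; exists (fun ib => a * c ib); rewrite mulr_sumr.
by apply: eq_bigr => ib _; rewrite rmorphM mulrA.
Qed.

Lemma in_span_sum I (r : seq I) (P : pred I) (g : I -> K) :
  (forall i, P i -> in_span (g i)) -> in_span (\sum_(i <- r | P i) g i).
Proof. by move=> Sg; apply: big_ind => //; [apply: in_span0 | apply: in_spanD]. Qed.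

Lemma in_span_monomial i b : (b < m)%N -> (i.+1 * m < n * b)%N -> in_span (x ^+ i / y ^+ b).
Proof.
move=> lt_bm lt_ib; have lt_in : (i < n)%N.
  by rewrite -(ltn_pmul2r m_gt0); nia.
pose ib := (Ordinal lt_in, Ordinal lt_bm).
exists (fun jc => if jc == ib then 1 else 0); rewrite (bigD1 ib) //= eqxx rmorph1 mul1r.
rewrite big1 ?addr0 // => jc /andP[_ /negPf->]; by rewrite rmorph0 mul0r.
Qed.

(** Choose b' < m with p b' = b mod m, say p b' = b + m l.  Then y^-b is
    (y^-b')^p (x^n + 1)^l, so C turns the monomial into multiples of x^i' y^-b'
    with p (i' + 1) <= i + 1 + n l, and these satisfy the same inequality. *)
Lemma cartier_span G : in_span G -> in_span (C G).
Proof.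
move=> [c ->]; rewrite cartier_sum; apply: in_span_sum => -[i b] adm_ib.
rewrite /=; have [a <-] := closed_nth_root (c (i, b)) (prime_gt0 p_pr).
rewrite rmorphXn cartierZ; apply: in_spanZ.
move: adm_ib; rewrite /admissible /monomial /= => lt_ib.
have lt_bm := ltn_ord b.
have b_gt0 : (0 < b)%N by move: lt_ib; case: (nat_of_ord b) => //; rewrite muln0.
have [u [v uv]] : exists u v, (u * p = (v * m).+1)%N.
  by apply: bezout_nat; rewrite ?prime_gt0 // coprime_sym.
pose b' := ((b * u) %% m)%N.
have pb' : (p * b' %% m)%N = b.
  rewrite modnMmr mulnCA mulnC [(p * u)%N]mulnC uv -addn1 mulnDl mul1n -mulnA mulnC -mulnA.
  by rewrite mulnC -modnDml modnMl add0n modn_small.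
pose l := (p * b' %/ m)%N.
have pb'E : (p * b' = b + m * l)%N by rewrite {1}(divn_eq (p * b') m) pb' addnC mulnC.
have lt_b'm : (b' < m)%N by rewrite ltn_mod.
have -> : x ^+ i / y ^+ b = (y^-1 ^+ b') ^+ p * (\sum_(k < l.+1) 'C(l, k)%:R * x ^+ (i + n * k)).
  have -> : \sum_(k < l.+1) 'C(l, k)%:R * x ^+ (i + n * k) = x ^+ i * y ^+ (m * l).
    rewrite exprM yE addrC exprDn mulr_sumr; apply: eq_bigr => k _.
    by rewrite expr1n mul1r -exprM exprD mulr_natl -mulrnAr.
  rewrite -exprM mulnC pb'E exprVn exprD; field.
  by rewrite !expf_neq0.
rewrite cartierZ cartier_sum mulr_sumr; apply: in_span_sum => k _.
rewrite -[C _]/(iter 1 C _) Cnat /= cartier_var.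
case: ifP => [/dvdnP[[|i'] //= E]|_]; last by rewrite !mulr0; apply: in_span0.
rewrite E mulnK ?prime_gt0 //= mulrCA exprVn [_ * x ^+ i']mulrC -(rmorph_nat iota); apply: in_spanZ.
apply: in_span_monomial => //.
have k_le : (k <= l)%N by rewrite -ltnS.
have p_gt0 := prime_gt0 p_pr.
rewrite -(ltn_pmul2r p_gt0).
have h1 : ((i + n * k).+1 * m <= i.+1 * m + n * (m * l))%N.
  by have := leq_mul (leqnn (n * m)%N) k_le; nia.
rewrite mulnAC -E (leq_ltn_trans h1) //.
by rewrite -mulnA [(b' * p)%N]mulnC pb'E mulnDr ltn_add2r.
Qed.

Lemma cartier_iter_span k G : in_span G -> in_span (iter k C G).
Proof. by move=> SG; elim: k => //= k; apply: cartier_span. Qed.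

Section Power.
Variables (h alpha beta : nat).
Hypotheses (han : (alpha * n = p ^ h - 1)%N) (hbm : (beta * m = p ^ h - 1)%N) (h_gt0 : (0 < h)%N).

Let q_gt1 : (1 < p ^ h)%N.
Proof. by rewrite -(exp1n h) ltn_exp2r // prime_gt1. Qed.

Definition monomial_eigenvalue (ib : 'I_n * 'I_m) : nat := 'C(ib.2 * beta, ib.1.+1 * alpha).

(** With q = p^h, y^-b is (y^-b)^q (x^n + 1)^(b beta), and the h-th iterate of C
    keeps from x^i (x^n + 1)^(b beta) only the terms with q dividing i + 1 + n k.
    Since q = n alpha + 1 this happens for k = (i + 1) alpha alone, and the
    term then gives back x^i. *)
Lemma cartier_iter_monomial ib : iter h C (mono ib) = (monomial_eigenvalue ib)%:R * mono ib.
Proof.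
case: ib => i b; rewrite /monomial_eigenvalue /monomial /=.
have lt_in := ltn_ord i; have lt_bm := ltn_ord b.
have qE : (p ^ h = n * alpha + 1)%N by lia.
have qE' : (p ^ h = m * beta + 1)%N by lia.
have lt_bb : (b * beta < m * beta)%N by rewrite ltn_pmul2r //; lia.
have monoE : x ^+ i / y ^+ b = (y^-1 ^+ b) ^+ (p ^ h) *
    (\sum_(k < (b * beta).+1) 'C(b * beta, k)%:R * x ^+ (i + n * k)).
  have -> : \sum_(k < (b * beta).+1) 'C(b * beta, k)%:R * x ^+ (i + n * k) =
      x ^+ i * y ^+ (m * (b * beta)).
    rewrite exprM yE addrC exprDn mulr_sumr; apply: eq_bigr => k _.
    by rewrite expr1n mul1r -exprM exprD mulr_natl -mulrnAr.
  rewrite -exprM qE' mulnDr muln1 mulnCA !exprVn exprD; field.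
  by rewrite !expf_neq0.
rewrite {1}monoE cartier_iterZ cartier_iter_sum mulr_sumr.
under eq_bigr => k _ do rewrite Cnat cartier_iter_var.
have div_k (k : 'I_(b * beta).+1) : (p ^ h %| (i + n * k).+1)%N = (k == i.+1 * alpha :> nat)%N.
  have lt_k : (k <= b * beta)%N by rewrite -ltnS.
  apply/dvdnP/eqP => [[s sE]|->]; last by exists i.+1; rewrite qE; lia.
  have lt_sn : (s < n)%N.
    rewrite -(ltn_pmul2r (ltnW q_gt1)) -sE.
    have : (n * k.+2 <= n * p ^ h)%N by rewrite leq_pmul2l // qE'; lia.
    by rewrite !mulnS; lia.
  have s_gt0 : (0 < s)%N by case: (s) sE.
  have smod : (s %% n = i.+1 %% n)%N.
    have E : (n * (s * alpha) + s = n * k + i.+1)%N by move: sE; rewrite qE; lia.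
    by move: (congr1 (modn^~ n) E); rewrite ![(n * _)%N]mulnC !modnMDl.
  have si : s = i.+1.
    move: smod; rewrite (modn_small lt_sn); move: lt_in; rewrite leq_eqVlt => /orP[/eqP->|lt].
      by rewrite modnn => E; rewrite E in s_gt0.
    by rewrite modn_small.
  have E : (n * k = n * (i.+1 * alpha))%N by move: sE; rewrite si qE; lia.
  by apply/eqP; rewrite -(eqn_pmul2l n_gt0) E.
have [le|lt] := leqP (i.+1 * alpha) (b * beta).
  rewrite (bigD1 (inord (i.+1 * alpha))) //= div_k inordK ?ltnS // eqxx big1 ?addr0 => [|k].
    have -> : ((i + n * (i.+1 * alpha)).+1 = i.+1 * p ^ h)%N by rewrite qE; lia.
    rewrite mulnK ?(ltnW q_gt1) //= exprVn; ring.
  rewrite div_k -(inj_eq val_inj) /= inordK ?ltnS // => /negPf->.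
  by rewrite !mulr0.
rewrite bin_small // mul0r big1 // => k _; rewrite div_k ifN ?mulr0 //.
by rewrite neq_ltn (leq_trans (ltn_ord k)).
Qed.

Section Theta.
Variable theta : F.
Hypothesis thetaP : (p ^ h - 1).-primitive_root theta.

(** The forms e_s = sum_(k < h) C^k (theta^s w) are fixed by C because w is fixed by
    C^h.  Since C^k (theta^s w) = theta^(s p^(h-k)) C^k w, orthogonality of the
    characters of the group generated by theta, which has p^h - 1 elements, gives
    sum_s theta^-s e_s = - w. *)
Lemma fixed_span w : iter h C w = w -> in_span w ->
  exists e : 'I_(p ^ h - 1) -> K, exists a : 'I_(p ^ h - 1) -> F,
    [/\ forall s, in_span (e s), forall s, C (e s) = e s & w = \sum_s iota (a s) * e s].
Proof.
move=> wh Sw; pose q1 := (p ^ h - 1)%N.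
have thq : theta ^+ (p ^ h) = theta.
  have -> : (p ^ h = q1 + 1)%N by rewrite subnK // ltnW.
  by rewrite exprD (prim_expr_order thetaP) mul1r expr1.
have th0 : theta != 0 by rewrite (prim_root_eq0 thetaP) -lt0n subn_gt0.
pose e (s : 'I_q1) := \sum_(k < h) iter k C (iota (theta ^+ s) * w).
exists e, (fun s => - (theta ^- s)); split=> [s|s|].
- apply: in_span_sum => k _; apply: cartier_iter_span; exact: in_spanZ.
- rewrite /e cartier_sum -(prednK h_gt0) big_ord_recr [in RHS]big_ord_recl /= addrC.
  congr (_ + _); rewrite -iterS prednK //.
  have {1}-> : theta ^+ s = (theta ^+ s) ^+ (p ^ h) by rewrite -exprM mulnC exprM thq.
  by rewrite CF wh.
- have q1K : q1%:R = -1 :> F.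
    apply/eqP; rewrite -addr_eq0 -[1]/1%:R -natrD subnK ?(ltnW q_gt1) //.
    by rewrite natrX pcharf0 // expr0n gtn_eqF.
  rewrite /e; under eq_bigr => s _ do rewrite mulr_sumr.
  rewrite exchange_big /=.
  have E (k : 'I_h) : \sum_(s < q1) iota (- theta ^- s) * iter k C (iota (theta ^+ s) * w)
      = iota (- \sum_(s < q1) theta ^+ (s * (p ^ (h - k) - 1))) * iter k C w.
    rewrite -sumrN rmorph_sum mulr_suml; apply: eq_bigr => s _.
    have thk : theta ^+ s = (theta ^+ (s * p ^ (h - k))) ^+ (p ^ k).
      by rewrite -exprM -mulnA -expnD subnK 1?ltnW // mulnC exprM thq.
    rewrite {2}thk CF mulrA -rmorphM mulNr; congr (iota (- _) * _).
    have pk_gt0 : (0 < p ^ (h - k))%N by rewrite expn_gt0 prime_gt0.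
    apply: (mulfI (expf_neq0 s th0)); rewrite mulVKf ?expf_neq0 //.
    by rewrite -exprD -mulnS subn1 prednK.
  under eq_bigr => k _ do rewrite E prim_root_sum //.
  rewrite (bigD1 (Ordinal h_gt0)) //= subn0 dvdnn q1K opprK rmorph1 mul1r.
  rewrite big1 ?addr0 // => k k0.
  have k_gt0 : (0 < k)%N by rewrite lt0n; apply: contra k0 => /eqP k0; apply/eqP/val_inj.
  rewrite gtnNdvd ?oppr0 ?rmorph0 ?mul0r //.
    by rewrite subn_gt0 -(exp1n (h - k)) ltn_exp2r ?prime_gt1 // subn_gt0.
  rewrite ltn_sub2r // ltn_exp2l ?prime_gt1 // ltn_subrL k_gt0 //.
Qed.

(** If mu^(q-1), q = p^h, is the eigenvalue of the monomial, then mu^q times the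
    monomial is fixed by the h-th iterate of C. *)
Lemma monomial_fixed_span ib : adm ib -> (monomial_eigenvalue ib)%:R != 0 :> F ->
  exists e : 'I_(p ^ h - 1) -> K, exists a : 'I_(p ^ h - 1) -> F,
    [/\ forall s, in_span (e s), forall s, C (e s) = e s & mono ib = \sum_s iota (a s) * e s].
Proof.
move=> adm_ib ev0; have q1_gt0 : (0 < p ^ h - 1)%N by rewrite subn_gt0.
have [mu muE] := closed_nth_root ((monomial_eigenvalue ib)%:R : F) q1_gt0.
have mu0 : mu != 0.
  by apply: contraNneq ev0 => mu0; rewrite -muE mu0 expr0n gtn_eqF.
have muq : mu ^+ (p ^ h) = mu * (monomial_eigenvalue ib)%:R.
  by rewrite -muE -exprS subn1 prednK // ltnW.
have Smono : in_span (mono ib) by apply: in_span_monomial; [apply: ltn_ord | apply: adm_ib].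
have [||e [a [Se Ce wE]]] := @fixed_span (iota (mu ^+ (p ^ h)) * mono ib).
- by rewrite CF cartier_iter_monomial mulrA muq rmorphM rmorph_nat.
- exact: in_spanZ.
exists e, (fun s => mu ^- (p ^ h) * a s); split=> //.
under eq_bigr => s _ do rewrite rmorphM -mulrA.
rewrite -mulr_sumr -wE mulrA -rmorphM mulVf ?expf_neq0 //.
by rewrite rmorph1 mul1r.
Qed.
End Theta.

(** The h-th iterate of C fixes the sum but kills the monomials whose eigenvalue is
    zero. *)
Lemma fixed_coefficient (c : 'I_n * 'I_m -> F) :
    (forall c' : 'I_n * 'I_m -> F, \sum_ib iota (c' ib) * mono ib = 0 -> forall ib, c' ib = 0) ->
    C (\sum_(ib | adm ib) iota (c ib) * mono ib) = \sum_(ib | adm ib) iota (c ib) * mono ib ->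
  forall ib, adm ib -> (monomial_eigenvalue ib)%:R = 0 :> F -> c ib = 0.
Proof.
move=> free CG ib adm_ib ev0.
have q_gt0 := ltnW q_gt1.
have [d dE] := choice (fun ib => closed_nth_root (c ib) q_gt0).
set G := \sum_(_ | _) _ in CG; have ChG : iter h C G = G.
  by elim: (h) => //= k ->.
pose c' ib := if adm ib then d ib * (monomial_eigenvalue ib)%:R - c ib else 0.
have /(_ ib) : forall ib, c' ib = 0.
  apply: free; rewrite (bigID adm) /= addrC big1 ?add0r => [|jc /negPf E]; last first.
    by rewrite /c' E rmorph0 mul0r.
  apply/eqP; rewrite -[X in _ == X](subrr G) -{1}ChG cartier_iter_sum -sumrB; apply/eqP.
  apply: eq_bigr => jc E; rewrite /c' E -{2}(dE jc) CF cartier_iter_monomial.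
  by rewrite rmorphB rmorphM rmorph_nat mulrBl mulrA.
by rewrite /c' adm_ib ev0 mulr0 sub0r => /eqP; rewrite oppr_eq0 => /eqP.
Qed.
End Power.
End Logarithms.

(** * Counting T *)

(** This follows from k binomial(q, k) = q binomial(q - 1, k - 1), as q does not divide k. *)
Lemma dvdn_bin_expn p h k : prime p -> (0 < k < p ^ h)%N -> (p %| 'C(p ^ h, k))%N.
Proof.
move=> p_pr /andP[k_gt0 lt_k]; apply: contraT => pC.
have : (p ^ h %| k * 'C(p ^ h, k))%N.
  by rewrite -(prednK k_gt0) -mul_bin_diag dvdn_mulr.
rewrite Gauss_dvdl ?coprimeXl ?prime_coprime // => /(dvdn_leq k_gt0).
by rewrite leqNgt lt_k.
Qed.

(** By Pascal's rule and the previous lemma, consecutive coefficients of this row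
    are opposite modulo p. *)
Lemma ndvdn_bin_pred_expn p h k : prime p -> (k <= p ^ h - 1)%N -> ~~ (p %| 'C(p ^ h - 1, k))%N.
Proof.
move=> p_pr; have q_gt0 : (0 < p ^ h)%N by rewrite expn_gt0 prime_gt0.
elim: k => [|k IH] le_k; first by rewrite bin0 dvdn1 neq_ltn prime_gt1 ?orbT.
have lt_k : (k.+1 < p ^ h)%N by lia.
apply: contra (IH (ltnW le_k)) => pk.
have := dvdn_bin_expn p_pr (h := h) (k := k.+1); rewrite lt_k => /(_ isT).
have {1}-> : (p ^ h = (p ^ h - 1).+1)%N by lia.
by rewrite binS dvdn_addr.
Qed.

Section Counting.
Variables (p m n h alpha beta : nat).
Hypotheses (p_pr : prime p) (m_gt0 : (0 < m)%N) (n_gt0 : (0 < n)%N) (h_gt0 : (0 < h)%N).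
Hypotheses (alpha_gt0 : (0 < alpha)%N) (beta_gt0 : (0 < beta)%N).
Hypotheses (han : (alpha * n = p ^ h - 1)%N) (hbm : (beta * m = p ^ h - 1)%N).

(** The elements of T off the sides of the triangle, with the first coordinate
    shifted by one. *)
Definition interior_pairs : {set 'I_n * 'I_m} :=
  [set ib | admissible ib && ~~ (p %| monomial_eigenvalue alpha beta ib)%N].

Local Notation q := (p ^ h)%N.
Local Notation T := (T_set p h alpha beta).

Let q_gt1 : (1 < q)%N.
Proof. by rewrite -(exp1n h) ltn_exp2r // prime_gt1. Qed.

Let z0 : 'I_q := Ordinal (ltnW q_gt1).
Let o (k : nat) : 'I_q := insubd z0 k.
Let oE k : (k <= q - 1)%N -> o k = k :> nat.
Proof. by move=> le; rewrite /o val_insubd ifT //; lia. Qed.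

Let le_n : (n <= q - 1)%N. Proof. by rewrite -han leq_pmull. Qed.
Let le_m : (m <= q - 1)%N. Proof. by rewrite -hbm leq_pmull. Qed.

Let in_T i j : (i <= n)%N -> (j <= m)%N ->
  ((o i, o j) \in T) = (i * alpha <= j * beta)%N && ~~ (p %| 'C(j * beta, i * alpha))%N.
Proof.
move=> le_i le_j; rewrite inE /= !oE ?(leq_trans le_i) ?(leq_trans le_j) //.
by have -> : (j * beta <= q - 1)%N by rewrite -hbm mulnC leq_pmul2l.
Qed.

Let T_bound (ij : 'I_q * 'I_q) : ij \in T ->
  exists i j, [/\ (i <= n)%N, (j <= m)%N & ij = (o i, o j)].
Proof.
case: ij => i j; rewrite inE /= => /and3P[le1 le2 _].
have le_j : (j <= m)%N by rewrite -(leq_pmul2r beta_gt0) [(m * _)%N]mulnC hbm.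
have le_i : (i <= n)%N.
  by rewrite -(leq_pmul2r alpha_gt0) [(n * _)%N]mulnC han (leq_trans le1).
by exists i, j; split=> //; congr pair; apply/val_inj; rewrite /= oE // -ltnS subn1 prednK // ltnW.
Qed.

Let o_inj i i' : o i = o i' -> (i <= q - 1)%N -> (i' <= q - 1)%N -> i = i'.
Proof. by move=> /(congr1 val) /= + le le'; rewrite !oE. Qed.

Let f0 (j : 'I_m.+1) := (o 0, o j).
Let f1 (i : 'I_n) := (o i.+1, o m).
Let g := gcdn m n.
Let m' := (m %/ g)%N.
Let n' := (n %/ g)%N.
Let f2 (k : 'I_g.-1) := (o (n' * k.+1), o (m' * k.+1)).
Let f3 (ib : 'I_n * 'I_m) := (o ib.1.+1, o ib.2).

Let g_gt0 : (0 < g)%N. Proof. by rewrite gcdn_gt0 m_gt0. Qed.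
Let mE : m = (m' * g)%N. Proof. by rewrite divnK // dvdn_gcdl. Qed.
Let nE : n = (n' * g)%N. Proof. by rewrite divnK // dvdn_gcdr. Qed.

Let compare i b : (i * alpha < b * beta)%N = (i * m < n * b)%N.
Proof.
have q1_gt0 : (0 < q - 1)%N by rewrite subn_gt0.
have mn_gt0 : (0 < m * n)%N by rewrite muln_gt0 m_gt0.
rewrite -(ltn_pmul2r mn_gt0) -[in RHS](ltn_pmul2r q1_gt0).
congr (_ < _)%N; first by rewrite -han; lia.
by rewrite -hbm; lia.
Qed.

Let compare_eq i b : (i * alpha == b * beta)%N = (i * m == n * b)%N.
Proof.
have q1_gt0 : (0 < q - 1)%N by rewrite subn_gt0.
have mn_gt0 : (0 < m * n)%N by rewrite muln_gt0 m_gt0.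
rewrite -(eqn_pmul2r mn_gt0) -[in RHS](eqn_pmul2r q1_gt0).
congr (_ == _)%N; first by rewrite -han; lia.
by rewrite -hbm; lia.
Qed.

(** The sides are i = 0, then j = m with i > 0, then the points
    (n' k, m' k), 0 < k < gcd(m, n), of the diagonal i alpha = j beta. *)
Let T_split : T = [set f0 j | j : 'I_m.+1] :|: [set f1 i | i : 'I_n]
  :|: [set f2 k | k : 'I_g.-1] :|: [set f3 ib | ib in interior_pairs].
Proof.
apply/setP => ij; apply/idP/idP => [Tij|].
  have [i [j [le_i le_j E]]] := T_bound Tij; rewrite {ij}E in Tij *.
  move: (Tij); rewrite in_T // => /andP[le_ij ndiv].
  case: i le_i Tij le_ij ndiv => [|i] le_i Tij le_ij ndiv.
    by rewrite !inE; apply/orP; left; apply/orP; left; apply/orP; left; apply/imsetP;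
      exists (Ordinal (le_j : (j < m.+1)%N)).
  move: le_j; rewrite leq_eqVlt => /orP[/eqP jm|lt_j].
    rewrite !inE; apply/orP; left; apply/orP; left; apply/orP; right; apply/imsetP.
    by exists (Ordinal le_i); rewrite // /f1 /= jm.
  move: le_ij; rewrite leq_eqVlt => /orP[|lt_ij].
    rewrite compare_eq => /eqP E; rewrite !inE; apply/orP; left; apply/orP; right.
    have E' : (i.+1 * m' = n' * j)%N.
      by apply/eqP; rewrite -(eqn_pmul2r g_gt0) -mulnA -mE E {1}nE; apply/eqP; lia.
    have cop : coprime n' m'.
      by rewrite /coprime -(eqn_pmul2r g_gt0) muln_gcdl -mE -nE mul1n gcdnC.
    have /dvdnP[k kE] : (n' %| i.+1)%N by rewrite -(Gauss_dvdl _ cop) E' dvdn_mulr.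
    have n'_gt0 : (0 < n')%N by move: n_gt0; rewrite nE muln_gt0 => /andP[].
    have jE : (j = m' * k)%N.
      by apply/eqP; rewrite -(eqn_pmul2l n'_gt0) -E' kE; apply/eqP; lia.
    have k_gt0 : (0 < k)%N by case: (k) kE.
    have m'_gt0 : (0 < m')%N by move: m_gt0; rewrite mE muln_gt0 => /andP[].
    have lt_k : (k.-1 < g.-1)%N.
      rewrite -ltnS !prednK // -(ltn_pmul2l m'_gt0) -jE -mE //.
    apply/imsetP; exists (Ordinal lt_k) => //.
    by rewrite /f2 /= prednK // jE kE [(k * _)%N]mulnC.
  rewrite !inE; apply/orP; right; apply/imsetP; exists (Ordinal le_i, Ordinal lt_j) => //.
  by rewrite inE /admissible /= -compare lt_ij.
rewrite !in_setU => /orP[/orP[/orP[|]|]|] /imsetP[k kP ->].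
- have le_k : (k <= m)%N by rewrite -ltnS.
  by rewrite /f0 in_T ?leq0n // mul0n bin0 dvdn1 neq_ltn prime_gt1 ?orbT.
- rewrite /f1 in_T // ?ltn_ord // [(m * _)%N]mulnC hbm.
  have le : (k.+1 * alpha <= q - 1)%N by rewrite -han mulnC leq_pmul2l // ltn_ord.
  by rewrite le ndvdn_bin_pred_expn.
- have le_k : (k.+1 <= g)%N by have := ltn_ord k; lia.
  have l1 : (n' * k.+1 <= n)%N by rewrite nE leq_mul2l le_k orbT.
  have l2 : (m' * k.+1 <= m)%N by rewrite mE leq_mul2l le_k orbT.
  rewrite /f2 in_T //.
  have /eqP -> : (n' * k.+1 * alpha == m' * k.+1 * beta)%N.
    by rewrite compare_eq {1}mE {1}nE; apply/eqP; lia.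
  by rewrite leqnn binn dvdn1 neq_ltn prime_gt1 ?orbT.
- move: kP; rewrite inE => /andP[]; case: k => i b.
  rewrite /admissible /monomial_eigenvalue /= -compare => lt nd.
  by rewrite /f3 in_T ?ltn_ord ?(ltnW (ltn_ord b)) //= (ltnW lt).
Qed.

Lemma card_T_set : (#|T| = m + n + gcdn m n + #|interior_pairs|)%N.
Proof.
have lt_q i : (i <= n)%N -> (i <= q - 1)%N by move/leq_trans; apply.
have lt_q' i : (i <= m)%N -> (i <= q - 1)%N by move/leq_trans; apply.
have m'_gt0 : (0 < m')%N by move: m_gt0; rewrite mE muln_gt0 => /andP[].
have n'_gt0 : (0 < n')%N by move: n_gt0; rewrite nE muln_gt0 => /andP[].
have k_n (k : 'I_g.-1) : (n' * k.+1 <= n)%N.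
  by rewrite {1}nE leq_mul2l; apply/orP; right; have := ltn_ord k; lia.
have k_m (k : 'I_g.-1) : (m' * k.+1 < m)%N.
  by rewrite [X in (_ < X)%N]mE ltn_pmul2l //; have := ltn_ord k; lia.
have f0_inj : injective f0.
  by move=> j j' [] /o_inj E; apply/val_inj/E; apply: lt_q'; rewrite -ltnS.
have f1_inj : injective f1.
  by move=> j j' [] /o_inj E; apply/val_inj; apply: succn_inj; apply: E; apply: lt_q.
have f2_inj : injective f2.
  move=> k k' [] /o_inj E _; apply/val_inj; apply: succn_inj; apply/eqP.
  by rewrite -(eqn_pmul2l n'_gt0); apply/eqP/E; apply: lt_q.
have f3_inj : injective f3.
  move=> [i b] [i' b'] [] /o_inj E /o_inj E'; congr pair; apply/val_inj.
    by apply: succn_inj; apply: E; apply: lt_q.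
  by apply: E'; apply: lt_q'; apply: ltnW.
have o0 i : (0 < i <= q - 1)%N -> o 0 != o i.
  by move=> /andP[i0 le]; apply/eqP => /o_inj E; move: i0; rewrite -E.
have om j : (j < m)%N -> o j != o m.
  by move=> lt; apply/eqP => /o_inj/(_ (lt_q' _ (ltnW lt)) le_m) E; rewrite E ltnn in lt.
rewrite T_split !cardsU (card_imset _ f0_inj) (card_imset _ f1_inj) (card_imset _ f2_inj).
rewrite (card_in_imset (in2W f3_inj)) !card_ord.
have -> : [set f0 j | j : 'I_m.+1] :&: [set f1 i | i : 'I_n] = set0.
  apply/setP => z; rewrite !inE; apply/negP => /andP[/imsetP[j _ ->] /imsetP[i _ []]].
  by move=> /eqP E _; move: E; apply/negP/o0; rewrite lt_q ?ltn_ord.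
have -> : ([set f0 j | j : 'I_m.+1] :|: [set f1 i | i : 'I_n]) :&: [set f2 k | k : 'I_g.-1] = set0.
  apply/setP => z; rewrite !inE; apply/negP => /andP[/orP[]] /imsetP[j _ ->] /imsetP[k _ []].
    by move=> /eqP E _; move: E; apply/negP/o0; rewrite lt_q ?muln_gt0 ?n'_gt0.
  by move=> _ /esym/eqP; apply/negP/om.
have -> : ([set f0 j | j : 'I_m.+1] :|: [set f1 i | i : 'I_n] :|: [set f2 k | k : 'I_g.-1])
    :&: [set f3 ib | ib in interior_pairs] = set0.
  apply/setP => z; rewrite !inE; apply/negP => /andP[/orP[/orP[]|]] /imsetP[j _ ->] /imsetP[[i b] iP []].
  - by move=> /eqP E _; move: E; apply/negP/o0; rewrite lt_q ?ltn_ord.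
  - by move=> _ /esym/eqP; apply/negP/om.
  - move: iP; rewrite inE /admissible /= => /andP[lt _].
    move=> /o_inj/(_ (lt_q _ (k_n j)) (lt_q _ (ltn_ord i))) Ei.
    move=> /o_inj/(_ (lt_q' _ (ltnW (k_m j))) (lt_q' _ (ltnW (ltn_ord b)))) Eb.
    move: lt; rewrite -Ei -Eb.
    have -> : (n' * j.+1 * m = n * (m' * j.+1))%N by rewrite {1}mE {1}nE; lia.
    by rewrite ltnn.
rewrite !cards0 !subn0 -/g; have := prednK g_gt0; move: g.-1 => u <-; by rewrite !addSn addnS addSn.
Qed.
End Counting.

(** * Differentials as multiples of dx *)

Section Differentials.
Variables (m n : nat) (F : closedFieldType) (K : fieldType).
Variables (iota : {rmorphism F -> K}) (x y : K).
Hypothesis hK : function_field_of iota (Fmn_poly F m n) x y.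
Hypotheses (m_gt0 : (0 < m)%N) (n_gt0 : (0 < n)%N).
Hypotheses (mF : m%:R != 0 :> F) (nF : n%:R != 0 :> F).
Variable D : {additive K -> K}.
Hypothesis DM : forall u v, D (u * v) = D u * v + u * D v.
Hypothesis DF : forall a, D (iota a) = 0.
Hypothesis Dx : D x = 1.
Variables (Om : lmodType K) (d : K -> Om).
Hypothesis hd : kaehler iota d.

Let dD := derivation_add (kaehler_derivation hd).
Let dM := derivation_mul (kaehler_derivation hd).
Let dF := derivation_const (kaehler_derivation hd).

Lemma differential_coord f : d f = D f *: d x.
Proof.
have d0 : d 0 = 0 by rewrite -(rmorph0 iota) dF.
have dN u : d (- u) = - d u.
  by apply/eqP; rewrite -addr_eq0 -dD addNr d0.
have dy : d y = D y *: d x.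
  have dX u k : d (u ^+ k) = (u ^+ k.-1 *+ k) *: d u.
    elim: k => [|k IHk]; first by rewrite expr0 -(rmorph1 iota) dF mulr0n scale0r.
    rewrite exprS dM IHk scalerA mulrnAr -scalerDl.
    by case: k {IHk} => [|k]; rewrite ?mulr0n ?add0r ?expr0 // -exprS -mulrSr.
  have := congr1 d (curve_eq hK); rewrite dD -(rmorph1 iota) dF addr0 !dX => E.
  have c0 : y ^+ m.-1 *+ m != 0.
    rewrite -mulr_natl mulf_neq0 ?(natr_image_neq0 iota mF) // expf_neq0 //.
    exact: (y_neq0 hK m_gt0 n_gt0).
  have := congr1 (fun v => (y ^+ m.-1 *+ m)^-1 *: v) E; rewrite !scalerA mulVf // scale1r => ->.
  congr (_ *: _); apply: (mulfI c0); rewrite mulVKf //.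
  rewrite (derivation_y hK m_gt0 n_gt0 mF DM Dx) -mulr_natl -[in RHS]mulr_natl.
  by field; rewrite (natr_image_neq0 iota mF) expf_neq0 // (y_neq0 hK m_gt0 n_gt0).
elim/(function_field_ind hK): f => [a||| u v IHu IHv | u v IHu IHv | u u0 IHu].
- by rewrite dF DF scale0r.
- by rewrite Dx scale1r.
- exact: dy.
- by rewrite dD dN IHu IHv raddfB scalerBl.
- by rewrite dM DM IHu IHv !scalerA -scalerDl addrC [D u * v]mulrC.
- have := dM u u^-1; rewrite divff // -(rmorph1 iota) dF => /esym/eqP.
  rewrite addr_eq0 => /eqP E.
  have := congr1 (fun v => u^-1 *: v) E; rewrite scalerA mulVf // scale1r => ->.
  rewrite scalerN scalerA IHu scalerA -scaleNr; congr (_ *: _).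
  by rewrite (derivationV DM u0); field.
Qed.

(** The universal property lifts D to [psi]; the map w -> psi(w) dx agrees with the
    identity on exact differentials, so it is the identity. *)
Lemma differential_line : exists psi : {linear Om -> K^o},
  (forall f, psi (d f) = D f) /\ forall w, w = (psi w : K) *: d x.
Proof.
have dD' : @derivation F K iota K^o D.
  split=> [a|f g|f g] //; first by rewrite raddfD.
  by rewrite DM addrC mulrC; congr (_ + _); rewrite mulrC.
have [psi psiE] := kaehler_lift hd dD'; exists psi; split=> // w.
pose r (w : Om) : Om := (psi w : K) *: d x.
have rL : linear r by move=> a u v; rewrite /r linearP scalerDl scalerA.
pose rm : {linear Om -> Om} := HB.pack r (GRing.isLinear.Build K Om Om *:%R r rL).
rewrite -[LHS]/((idfun : {linear Om -> Om}) w).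
have := kaehler_unique hd (psi1 := idfun) (psi2 := rm); apply.
by move=> f; rewrite /= /r psiE -differential_coord.
Qed.
End Differentials.

(** * The p-rank *)

Theorem theorem1p1 (p m n h alpha beta : nat)
    (hp : prime p) (hm : (2 <= m)%N) (hn : (2 <= n)%N)
    (hmp : coprime m p) (hnp : coprime n p)
    (hh : (0 < h)%N) (halpha : (0 < alpha)%N) (hbeta : (0 < beta)%N)
    (han : (alpha * n = p ^ h - 1)%N) (hbm : (beta * m = p ^ h - 1)%N)
    (F : closedFieldType) (phi : {rmorphism 'F_p -> F})
    (hF : algebraic_closure_Fp phi)
    (K : fieldType) (iota : {rmorphism F -> K}) (x y : K)
    (hK : function_field_of iota (Fmn_poly F m n) x y)
    (Om : lmodType K) (d : K -> Om) (hd : kaehler iota d) :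
  exists g : nat,
    has_p_rank iota d g /\
    g%:Z = #|T_set p h alpha beta|%:Z - (m + n + gcdn m n)%:Z.
Proof.
have m_gt0 := ltnW hm; have n_gt0 := ltnW hn.
have chF : p \in [pchar F] by rewrite (fmorph_pchar phi) (pchar_Fp hp).
have natF k : coprime k p -> k%:R != 0 :> F.
  by move=> kp; rewrite -(dvdn_pcharf chF) -prime_coprime // coprime_sym.
have [mF nF] := (natF m hmp, natF n hnp).
have q1F : (p ^ h - 1)%:R != 0 :> F.
  apply: natF; rewrite coprime_sym prime_coprime //; apply/negP => pq.
  have : (p %| p ^ h)%N by rewrite -(prednK hh) expnS dvdn_mulr.
  have -> : (p ^ h = (p ^ h - 1) + 1)%N by rewrite subnK // expn_gt0 prime_gt0.
  by rewrite dvdn_addr // dvdn1 => /eqP p1; move: hp; rewrite p1.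
have [D [DM DF Dx]] := derivation_ex hK m_gt0 n_gt0 mF.
have [zeta zetaP] := closed_prim_root mF.
have [theta thetaP] := closed_prim_root q1F.
have sgE k : exists s : {rmorphism K -> K},
    [/\ forall a, s (iota a) = iota a, s x = x & s y = iota (zeta ^+ k) * y].
  apply: (automorphism_ex hK); rewrite // -exprM mulnC exprM.
  by rewrite (prim_expr_order zetaP) expr1n.
have [sg sgP] := choice sgE.
have sgF k a : sg k (iota a) = iota a by case: (sgP k).
have sgx k : sg k x = x by case: (sgP k).
have sgy k : sg k y = iota (zeta ^+ k) * y by case: (sgP k).
have [psi [psid psiE]] := differential_line hK m_gt0 n_gt0 mF DM DF Dx hd.
have dxpsi (G : K) : psi (G *: d x) = G by rewrite linearZ /= psid Dx /GRing.scale /= mulr1.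
set gen := frobenius_generated hK m_gt0 n_gt0 chF hmp.
set chp := function_field_pchar iota chF.
pose mono := @monomial m n K x y.
have free := monomial_free hK m_gt0 n_gt0 mF zetaP sgF sgx sgy.
have hol_regular w : holomorphic iota d w -> forall O, place iota O -> regular D O (psi w).
  move=> hw O hO; have [t [g [tP Og ->]]] := hw O hO.
  by exists t, g; split=> //; rewrite linearZ /= psid.
have span_hol G : in_span m n iota x y G -> holomorphic iota d (G *: d x).
  move=> [c ->] O hO.
  have [t [[tP Dt0 _] tO]] := monomial_regular hK m_gt0 n_gt0 mF nF DM DF Dx zetaP sgF sgx sgy hO.
  exists t, ((\sum_(ib | admissible ib) iota (c ib) * mono ib) / D t); split=> //.
    rewrite mulr_suml; apply: (place_bigsum hO) => ib adm_ib; rewrite -mulrA.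
    apply: (place_mul hO); first exact: (place_const hO).
    by apply: tO; [apply: ltn_ord | apply: adm_ib].
  by rewrite (differential_coord hK m_gt0 n_gt0 mF DM DF Dx hd t) scalerA divfK.
pose B := interior_pairs p m n alpha beta.
exists #|B|; split; last first.
  rewrite (card_T_set hp m_gt0 n_gt0 hh halpha hbeta han hbm) PoszD addrC addKr //.
pose e (k : 'I_#|B|) : Om := mono (enum_val k) *: d x.
exists e; split.
- move=> k; have := enum_valP k; rewrite inE => /andP[adm_k ndiv].
  have ev0 : (monomial_eigenvalue alpha beta (enum_val k))%:R != 0 :> F by rewrite -(dvdn_pcharf chF).
  have [f [a [Sf Cf E]]] := monomial_fixed_span hK m_gt0 n_gt0 chF hmp DM Dx han hbm hh thetaP adm_k ev0.
  exists (p ^ h - 1)%N, a, (fun s => f s *: d x); split=> [s|].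
    split; first exact: span_hol.
    have [u u0 uE] := cartier_fixed (Cf s); exists u => //.
    rewrite (differential_coord hK m_gt0 n_gt0 mF DM DF Dx hd u) scalerA uE.
    by congr (_ *: _); field.
  rewrite /e /lincomb [mono _]E scaler_suml; apply: eq_bigr => s _.
  by rewrite scalerA.
- move=> a a0 k.
  have E0 : \sum_(k < #|B|) iota (a k) * mono (enum_val k) = 0.
    rewrite -[LHS]dxpsi scaler_suml.
    have -> : \sum_(k < #|B|) (iota (a k) * mono (enum_val k)) *: d x = lincomb iota a e.
      by apply: eq_bigr => j _; rewrite scalerA.
    by rewrite a0 linear0.
  pose c ib := \sum_(j < #|B| | enum_val j == ib) a j.
  have : \sum_ib iota (c ib) * mono ib = 0.
    rewrite -[RHS]E0 (partition_big (fun j : 'I_#|B| => enum_val j) xpredT) //=.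
    apply: eq_bigr => ib _; rewrite rmorph_sum mulr_suml.
    by apply: eq_bigr => j /eqP->.
  move/free/(_ (enum_val k)); rewrite /c (bigD1 k) //= big1 ?addr0 // => j /andP[/eqP/enum_val_inj->].
  by rewrite eqxx.
- move=> w [r [a [f [fP ->]]]].
  have fB j : exists b : 'I_#|B| -> F, f j = lincomb iota b e.
    have [hol [u u0 uE]] := fP j.
    have [c cE] := regular_span hK m_gt0 n_gt0 mF nF DM DF Dx zetaP sgF sgx sgy (hol_regular _ hol).
    have psiu : psi (f j) = D u / u by rewrite uE linearZ /= psid mulrC.
    have Cfix : cartier DM chp Dx gen (psi (f j)) = psi (f j).
      by rewrite psiu cartier_logarithmic.
    exists (fun k => c (enum_val k)); rewrite [LHS]psiE cE scaler_suml.
    rewrite cE in Cfix; have c0 := fixed_coefficient han hbm hh free Cfix.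
    rewrite (bigID (mem B)) /= [X in _ + X]big1 ?addr0 => [|ib /andP[adm_ib]]; last first.
      rewrite inE adm_ib negbK (dvdn_pcharf chF) => /eqP ev0.
      by rewrite c0 // rmorph0 mul0r scale0r.
    rewrite (eq_bigl (mem B)) => [|ib]; last by rewrite /= inE andbA andbb.
    by rewrite big_enum_val; apply: eq_bigr => k _; rewrite -scalerA.
  have [b bE] := choice fB.
  exists (fun k => \sum_(j < r) a j * b j k).
  rewrite /lincomb; under eq_bigr => j _ do rewrite bE /lincomb scaler_sumr.
  rewrite exchange_big; apply: eq_bigr => k _; rewrite rmorph_sum scaler_suml.
  by apply: eq_bigr => j _; rewrite scalerA rmorphM.
Qed.
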